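(* Let $\epsilon\in(0,\infty)$, $\alpha\in[0,1)$, $\beta\in(\alpha^2,1)$, $p\in[2,\infty)$, and let $(\gamma_n)_{n\in\mathbb N}\subseteq(0,\infty)$ be a non-summable decreasing sequence converging to zero which satisfies $\sup_{\varepsilon\in(0,\infty)}\liminf_{n\to\infty}\bigl((\gamma_n)^{-1}\gamma_{n+\lceil(\gamma_n)^{-1}\varepsilon\rceil}\bigr)>0$ and $\sum_{n=1}^\infty(\gamma_n)^{1+p/3}<\infty$. Let $d\in\mathbb N$, $\vartheta\in\mathbb R^d$, let $(X,U)$ be a locally $p$-regular innovation, and let $(\theta_n)_{n\in\mathbb N_0}$ be the Adam algorithm with innovation $(X,U)$, step-sizes $(\gamma_n)_{n\in\mathbb N}$ and damping parameters $(\alpha,\beta,\epsilon)$ started in $\vartheta$. Let $p_1,p_2,q\in(0,\infty)$ with $1<p_2\le2$, $\frac12p_2+1<p_1\le\frac32p_2$ and $q<\sqrt\beta$. Let $R:\mathbb R^d\to\mathbb R$ be a $C^1$-function such that $\mathbb E[X(U,\theta)]=-\nabla R(\theta)$ for all $\theta\in\mathbb R^d$. Let $\mathcal C\subset\mathbb R^d$ be a closed, non-empty set of critical points of $R$ and let $K\subset\mathbb R^d$ be compact. Assume that there exist an open neighborhood $\mathcal D\supset\mathcal C\cap K$ and constants $C_1,C_2\in(0,\infty)$ such that $$\mathcal C\cap\overline{\mathcal D}=\arg\min R\big|_{\overline{\mathcal D}}=\{\theta\in\overline{\mathcal D}:\nabla R(\theta)=0\}$$ and such that for all $\theta\in\mathcal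 D$ and $i=1,\dots,d$ $$\mathbb E\bigl[|X^{(i)}(U,\theta)|^3\bigr]\le C_1|\nabla R(\theta)|^{p_1}\quad\text{and}\quad\mathbb P\bigl(|X^{(i)}(U,\theta)|^2<C_2|\nabla R^{(i)}(\theta)|^{p_2}\bigr)\le q .$$ Then there exists a neighborhood $V$ of $\mathcal C\cap K$ such that for almost all $$\omega\in\bigl\{\theta_n\in V\text{ for infinitely many }n\in\mathbb N_0\bigr\}\cap\bigcup_{n_0\in\mathbb N_0}\bigcap_{n\ge n_0}\{\theta_n\in K\}$$ one has $\lim_{n\to\infty}\operatorname{dist}(\theta_n(\omega),\mathcal C)=0$.
   Context: Innovation: a pair $(X,U)$ where $U$ is a random variable on a probability space $(\Omega,\mathcal F,\mathbb P)$ with values in a measurable space $\mathcal U$ and $X:\mathcal U\times\mathbb R^d\to\mathbb R^d$ is product measurable. $X^{(j)}$ is the $j$-th component; $\nabla R^{(i)}(\theta)$ is the $i$-th component of $\nabla R(\theta)$; $\operatorname{dist}(\theta,\mathcal C)$ is the Euclidean distance from $\theta$ to $\mathcal C$. For $p\in[2,\infty)$, $(X,U)$ is locally $p$-regular if there is a continuous $c:\mathbb R\to\mathbb R$ such that for all $\theta,\vartheta\in\mathbb R^d$: $\mathbb E[|X(U,\theta)|^p]\le c(0)(1+e^{c(0)|\theta|})$ and $\mathbb E[|X(U,\theta)-X(U,\vartheta)|^p]\le c(|\theta|+|\vartheta|)\,|\theta-\vartheta|^p$. Adam algorithm with innovation $(X,U)$, step-sizes $(\gamma_n)_{n\in\mathbb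 N}$, damping parameters $(\alpha,\beta,\epsilon)$, started in $\vartheta$: a process $(\theta_n)_{n\in\mathbb N_0}$ in $\mathbb R^d$ for which there are i.i.d. copies $U_1,U_2,\dots$ of $U$ such that $\theta_0=\vartheta$, $m_0=v_0=0\in\mathbb R^d$, and for all $n\in\mathbb N$, $j\in\{1,\dots,d\}$: $$m_n=\alpha m_{n-1}+(1-\alpha)X(U_n,\theta_{n-1}),\quad v_n^{(j)}=\beta v_{n-1}^{(j)}+(1-\beta)(X^{(j)}(U_n,\theta_{n-1}))^2,$$ $$\sigma_n^{(j)}=\bigl(\sqrt{v_n^{(j)}/(1-\beta^n)}+\epsilon\bigr)^{-1},\quad \theta_n^{(j)}=\theta_{n-1}^{(j)}+\gamma_n\sigma_n^{(j)}m_n^{(j)}.$$ *)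

(* Defs.v *)
From HB Require Import structures.
From mathcomp Require Import all_boot all_order all_algebra finmap.
From mathcomp Require Import all_classical all_reals all_analysis.

Set Implicit Arguments.
Unset Strict Implicit.
Unset Printing Implicit Defensive.

Import Order.TTheory GRing.Theory Num.Theory.
Import numFieldNormedType.Exports.

Local Open Scope classical_set_scope.
Local Open Scope ring_scope.

(* R^d is 'rV[R]_d. The library norm `|x| on row vectors is the sup norm, so
   the Euclidean norm and distance are defined here; both norms induce the
   topology and the differentiability notion that the library puts on
   'rV[R]_d. *)
Definition enorm (R : realType) (d : nat) (x : 'rV[R]_d) : R :=
  Num.sqrt (\sum_(i < d) x ord0 i ^+ 2).

Definition edist_set (R : realType) (d : nat) (x : 'rV[R]_d)
    (C : set 'rV[R]_d) : R :=
  inf [set enorm (x - y) | y in C].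

Definition grad (R : realType) (d : nat) (f : 'rV[R]_d -> R)
    (x : 'rV[R]_d) : 'rV[R]_d :=
  \row_i 'D_(delta_mx ord0 i) f x.

Definition is_C1 (R : realType) (d : nat) (f : 'rV[R]_d -> R) : Prop :=
  (forall x, differentiable f x) /\ continuous (grad f).

Definition argmin_on (T : Type) (R : realType) (f : T -> R) (A : set T) :
    set T :=
  [set x | A x /\ forall y, A y -> f x <= f y].

Definition borelRV (R : realType) (d : nat) :=
  g_sigma_algebraType (@open 'rV[R]_d).

Definition product_measurable (R : realType) (d : nat) (disp : measure_display)
    (S : measurableType disp) (X : S -> 'rV[R]_d -> 'rV[R]_d) : Prop :=
  measurable_fun [set: S * borelRV R d]
    (fun z : S * borelRV R d => X z.1 z.2 : borelRV R d).

(* Mutual independence of the random variables Y i, i in D: the product rule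
   for every finite subfamily. *)
Definition mutually_independent (dO dS : measure_display)
    (Omega : measurableType dO) (S : measurableType dS) (R : realType)
    (P : probability Omega R) (I : choiceType) (D : set I)
    (Y : I -> {RV P >-> S}) : Prop :=
  forall J : {fset I}, [set` J] `<=` D ->
  forall A : I -> set S, (forall i, i \in J -> measurable (A i)) ->
    P (\bigcap_(i in [set` J]) Y i @^-1` A i) =
    (\prod_(i <- J) P (Y i @^-1` A i))%E.

(* Us 1, Us 2, ... are i.i.d. copies of U; Us 0 is unconstrained. *)
Definition iid_copies (dO dS : measure_display)
    (Omega : measurableType dO) (S : measurableType dS) (R : realType)
    (P : probability Omega R) (U : {RV P >-> S}) (Us : nat -> {RV P >-> S}) :
    Prop :=
  (forall n, (0 < n)%N -> forall A, measurable A ->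
     distribution P (Us n) A = distribution P U A) /\
  mutually_independent [set n | (0 < n)%N] Us.

Definition locally_regular (dO dS : measure_display)
    (Omega : measurableType dO) (S : measurableType dS) (R : realType)
    (P : probability Omega R) (d : nat) (p : R)
    (X : S -> 'rV[R]_d -> 'rV[R]_d) (U : {RV P >-> S}) : Prop :=
  exists c : R -> R, [/\ continuous c,
    (forall x : 'rV[R]_d,
       ('E_P[fun w => (enorm (X (U w) x) `^ p)%R]
        <= (c 0 * (1 + expR (c 0 * enorm x)))%:E)%E) &
    (forall x y : 'rV[R]_d,
       ('E_P[fun w => (enorm (X (U w) x - X (U w) y) `^ p)%R]
        <= (c (enorm x + enorm y) * enorm (x - y) `^ p)%:E)%E)].

(* gamma 1, gamma 2, ... are the step sizes; gamma 0 is not used. *)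
Definition is_adam (dO dS : measure_display)
    (Omega : measurableType dO) (S : measurableType dS) (R : realType)
    (P : probability Omega R) (d : nat)
    (X : S -> 'rV[R]_d -> 'rV[R]_d) (U : {RV P >-> S})
    (gamma : nat -> R) (alpha beta eps : R) (x0 : 'rV[R]_d)
    (theta : nat -> Omega -> 'rV[R]_d) : Prop :=
  exists (Us : nat -> {RV P >-> S}) (m v sigma : nat -> Omega -> 'rV[R]_d),
    [/\ iid_copies U Us,
        (forall w, [/\ theta 0%N w = x0, m 0%N w = 0 & v 0%N w = 0]) &
        forall (n : nat) (w : Omega) (j : 'I_d),
        let G := X (Us n.+1 w) (theta n w) in
        [/\ m n.+1 w ord0 j =
              alpha * m n w ord0 j + (1 - alpha) * G ord0 j,
            v n.+1 w ord0 j =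
              beta * v n w ord0 j + (1 - beta) * (G ord0 j) ^+ 2,
            sigma n.+1 w ord0 j =
              (Num.sqrt (v n.+1 w ord0 j / (1 - beta ^+ n.+1)) + eps)^-1 &
            theta n.+1 w ord0 j =
              theta n w ord0 j
              + gamma n.+1 * sigma n.+1 w ord0 j * m n.+1 w ord0 j]].

(* Main.v *)
Require Import Defs.
From HB Require Import structures.
From mathcomp Require Import all_boot all_order all_algebra finmap.
From mathcomp Require Import all_classical all_reals all_analysis.
From mathcomp Require Import measurable_realfun ring lra.

(** The iterates of Adam move like a perturbed gradient descent for the
objective [f], whatever second moment Adam divides by, once they are close to
a set of critical points at which the innovation vanishes fast enough.

By Cauchy-Schwarz and [alpha ^+ 2 < beta], the square of the momentum is
dominated by the second moment estimate, so each step has length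
[O(gamma n)].  Moreover [m / (sqrt v + eps)] differs from [m / eps] by at most a
constant times a discounted sum of [x ^+ 2 / (|x| + c)], where [x] runs through
the past innovations ([adam_direction_linearized]).  Near the critical points
the third moment of the innovation is [O(|grad f| ^ p1)] with [p1 > 3 / 2],
which interpolates to a second moment [o(|grad f|)]
([tempered_sqr_moment_le]).  So the average direction of Adam is
[- eps^-1 * grad f + o(|grad f|)], and [f] is a strict Lyapunov function.

It remains to see that the noise is harmless.  Over a window [n <= k < N] of
indices, the martingale sum of [gamma k.+1 * noise k] should be small
compared with [1 + sum gamma k.+1], simultaneously for all late windows.  This
is [noise_drift_le].  The noise has only [p] moments: it is truncated at the level
[gamma ^ (- kap)] with [kap = 1 / 3 + 1 / p], which almost surely is
eventually never exceeded since [sum gamma ^ (1 + p / 3)] converges; as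
[kap < 1], exponential supermartingales of the truncated noise are available
and their tails are smaller than any power of [gamma].  The maximal inequality
for these supermartingales rests on the independence of an innovation from the
past ([freezing]).

The rest is deterministic ([confined_descent_cvg]).  Cut time into windows of a
small fixed length in the clock [sum gamma].  Over a window, [f] decreases by
a fixed amount unless it is already close to its minimum
([window_descent]); near [C] and inside [K], small values of [f] force closeness
to [C]; so a trajectory that enters the neighbourhood [V] late enough can
never leave a slightly larger one, and [f] tends to its minimal value along it.
The window length is chosen after the modulus of continuity of [grad f] near
[K]. *)

Set Implicit Arguments.
Unset Strict Implicit.
Unset Printing Implicit Defensive.

Import Order.TTheory GRing.Theory Num.Theory.
Import numFieldNormedType.Exports.

Local Open Scope classical_set_scope.
Local Open Scope ring_scope.

(** * Elementary inequalities *)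

(** The constant [2] leaves room to bound [expR x] by [(1 - x)^-1], which needs no
power series. *)
Lemma expR_le_quadratic (R : realType) (x : R) :
  x <= 1 / 2 -> expR x <= 1 + x + 2 * x ^+ 2.
Proof.
move=> x_le.
have x1 : 0 < 1 - x by lra.
have : expR x <= (1 - x)^-1.
  rewrite -[leLHS]invrK -expRN lef_pV2 ?posrE ?expR_gt0//.
  exact: expR_ge1Dx.
move=> /le_trans; apply.
rewrite -[leLHS]mul1r ler_pdivrMr//; nra.
Qed.

(** Bernoulli: the chord of the convex function [expR] from [0] to [ln r]
dominates it at [s * ln r]; the chord is compared with the tangent there. *)
Lemma powR_le_tangent (R : realType) (r s : R) :
  0 < r -> 0 <= s <= 1 -> r `^ s <= 1 + s * (r - 1).
Proof.
move=> r_gt0 /andP[s_ge0 s_le1].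
rewrite {1}/powR gt_eqF// -{2}(lnK r_gt0); set L := ln r.
have E (z : R) : expR (s * L) * (1 + (z - s * L)) <= expR z.
  rewrite -{2}(subrK (s * L) z) expRD mulrC ler_pM2r ?expR_gt0//.
  exact: expR_ge1Dx.
have := E L; have := E 0; rewrite expR0.
have := expR_gt0 (s * L); set y := expR _; set w := expR _; nra.
Qed.

(** Makes the total variation of a decreasing sequence, weighted by a negative power
of the sequence, telescope. *)
Lemma powR_sub_ge (R : realType) (a b s : R) :
  0 < b -> b <= a -> 0 < s <= 1 ->
  (a - b) * a `^ (s - 1) <= s^-1 * (a `^ s - b `^ s).
Proof.
move=> b_gt0 b_le_a /andP[s_gt0 s_le1].
have a_gt0 : 0 < a by apply: lt_le_trans b_le_a.
have aE : a `^ s = a * a `^ (s - 1).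
  by rewrite -{2}[a](powRr1 (ltW a_gt0)) -powRD ?gt_eqF ?implybT// addrC subrK.
have bE : b `^ s = (b / a) `^ s * a `^ s.
  rewrite -powRM ?divr_ge0 ?ltW//.
  by rewrite divfK ?gt_eqF.
have := @powR_le_tangent R (b / a) s (divr_gt0 b_gt0 a_gt0).
rewrite (ltW s_gt0) s_le1 => /(_ isT) H.
rewrite ler_pdivlMl//.
have P0 : 0 < a `^ (s - 1) by exact: powR_gt0.
rewrite bE aE.
set rs := (b / a) `^ s in H *; set P := a `^ (s - 1) in P0 *.
have -> : a * P - rs * (a * P) = (1 - rs) * (a * P) by ring.
have -> : s * ((a - b) * P) = (s * (1 - b / a)) * (a * P).
  field; exact: lt0r_neq0.
apply: ler_wpM2r; first by rewrite mulr_ge0 ?ltW.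
lra.
Qed.

(** Exponential tails beat every power: [expR (y / N)] is at least [y / N], then
raise to the power [N]. *)
Lemma expRN_le_powR (R : realType) (N y : R) :
  0 < N -> 0 < y -> expR (- y) <= N `^ N * y `^ (- N).
Proof.
move=> N_gt0 y_gt0.
have yN : 0 < y / N by exact: divr_gt0.
have H : (y / N) `^ N <= expR y.
  rewrite {1}/powR gt_eqF// ler_expR.
  have -> : y = N * (y / N) by field; exact: lt0r_neq0.
  rewrite ler_pM2l//.
  have -> : N * (y / N) / N = y / N by field; exact: lt0r_neq0.
  by rewrite -ler_expR lnK// (le_trans _ (expR_ge1Dx _))// lerDr ler01.
have E : (y / N) `^ N = (N `^ N * y `^ (- N))^-1.
  rewrite powRM ?invr_ge0 ?ltW// powRN invfM invrK mulrC; congr (_ * _).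
  by rewrite -powR_inv1 ?ltW// -powRrM mulN1r powRN.
rewrite expRN -[leRHS]invrK -E lef_pV2 ?posrE ?expR_gt0//.
by rewrite powR_gt0.
Qed.

(** Cauchy-Schwarz in Engel form; it encodes the convexity of [x ^+ 2 / y]. *)
Lemma Titu_le (R : realFieldType) (a b c d : R) :
  0 < c -> 0 < d -> (a + b) ^+ 2 / (c + d) <= a ^+ 2 / c + b ^+ 2 / d.
Proof.
move=> c_gt0 d_gt0; rewrite -subr_ge0.
have -> : a ^+ 2 / c + b ^+ 2 / d - (a + b) ^+ 2 / (c + d)
    = (a * d - b * c) ^+ 2 / (c * d * (c + d)).
  by field; rewrite ?lt0r_neq0 ?addr_gt0.
by rewrite divr_ge0 ?sqr_ge0// !mulr_ge0 ?addr_ge0 ?ltW.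
Qed.

(** * The Adam direction for small innovations *)

Fixpoint discounted_sum (R : realType) (b : R) (y : nat -> R) (n : nat) : R :=
  if n is n'.+1 then b * discounted_sum b y n' + y n' else 0.

Lemma discounted_sum_ge0 (R : realType) (b : R) (y : nat -> R) n :
  0 <= b -> (forall k, 0 <= y k) -> 0 <= discounted_sum b y n.
Proof.
by move=> b0 y0; elim: n => [//|n IH] /=; rewrite addr_ge0// mulr_ge0.
Qed.

(** Behaves like [x ^+ 2] near [0] and like [`|x|] at infinity: it has as many
moments as [x], and its mean is small as soon as the second moment is. *)
Definition tempered_sqr (R : realType) (c x : R) : R := x ^+ 2 / (`|x| + c).

Lemma tempered_sqr_ge0 (R : realType) (c x : R) : 0 < c -> 0 <= tempered_sqr c x.
Proof. by move=> c0; rewrite divr_ge0 ?sqr_ge0// addr_ge0// ltW. Qed.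

Lemma tempered_sqr_le_norm (R : realType) (c x : R) : 0 < c -> tempered_sqr c x <= `|x|.
Proof.
move=> c0; rewrite /tempered_sqr ler_pdivrMr ?ltr_wpDl// -(real_normK (num_real x)).
by rewrite expr2 ler_wpM2l// lerDl ltW.
Qed.

Lemma tempered_sqr_le_sqr (R : realType) (c x : R) : 0 < c -> tempered_sqr c x <= x ^+ 2 / c.
Proof.
move=> c0; rewrite /tempered_sqr ler_wpM2l ?sqr_ge0// lef_pV2 ?posrE ?ltr_wpDl//.
by rewrite lerDr.
Qed.

Lemma tempered_sqr_mono (R : realType) (c x y : R) :
  0 < c -> 0 <= x -> x <= y -> tempered_sqr c x <= tempered_sqr c y.
Proof.
move=> c0 x0 xy; have y0 := le_trans x0 xy.
rewrite /tempered_sqr !ger0_norm// ler_pdivrMr ?ltr_wpDl// mulrAC ler_pdivlMr ?ltr_wpDl//.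
rewrite -subr_ge0.
have -> : y ^+ 2 * (x + c) - x ^+ 2 * (y + c) = (y - x) * (x * y + c * (x + y)) by ring.
have yx : 0 <= y - x by rewrite subr_ge0.
have cge := ltW c0.
by apply: mulr_ge0 => //; rewrite addr_ge0 ?mulr_ge0 ?addr_ge0.
Qed.

(** Convexity of [tempered_sqr eps] at the convex combination
[b * r + (1 - b) * (x / (1 - b))]; dividing the second
argument by [1 - b] turns the constant [eps] into [(1 - b) * eps]. *)
Lemma tempered_sqr_add_le (R : realType) (b eps r x : R) :
  0 < eps -> 0 < b -> b < 1 -> 0 <= r -> 0 <= x ->
  tempered_sqr eps (b * r + x) <= b * tempered_sqr eps r + tempered_sqr ((1 - b) * eps) x.
Proof.
move=> e0 b0 b1 r0 x0.
have b10 : 0 < 1 - b by lra.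
rewrite /tempered_sqr !ger0_norm ?addr_ge0 ?mulr_ge0 ?(ltW b0)//.
have := @Titu_le R (b * r) x (b * (r + eps)) (x + (1 - b) * eps).
rewrite mulr_gt0 ?ltr_wpDl// ?ltr_wpDl ?mulr_gt0// => /(_ isT isT).
have -> : b * (r + eps) + (x + (1 - b) * eps) = b * r + x + eps by ring.
have -> // : (b * r) ^+ 2 / (b * (r + eps)) = b * (r ^+ 2 / (r + eps)).
by field; rewrite ?lt0r_neq0 ?ltr_wpDl.
Qed.

(** The induction step is a quadratic form in [(m n, x n)]; the constant is the one
for which its discriminant vanishes, and [a ^+ 2 < b] makes it finite. *)
Lemma momentum_sqr_le (R : realType) (a b : R) (x m v : nat -> R) :
  a ^+ 2 < b -> b < 1 -> m 0%N = 0 -> v 0%N = 0 ->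
  (forall n, m n.+1 = a * m n + (1 - a) * x n) ->
  (forall n, v n.+1 = b * v n + (1 - b) * x n ^+ 2) ->
  forall n, m n ^+ 2 <= (1 - a) ^+ 2 * b / ((b - a ^+ 2) * (1 - b)) * v n.
Proof.
move=> ab b1 m0 v0 mS vS n.
have ba0 : 0 < b - a ^+ 2 by lra.
have b10 : 0 < 1 - b by lra.
have nn := (lt0r_neq0 ba0, lt0r_neq0 b10).
have b0 : 0 < b by apply: le_lt_trans ab; exact: sqr_ge0.
set c := (X in X * _).
elim: n => [|n IH]; first by rewrite m0 v0 expr0n mulr0.
rewrite mS vS mulrDr.
(* completing the square in [m n] *)
have step : (a * m n + (1 - a) * x n) ^+ 2
    <= b * m n ^+ 2 + c * ((1 - b) * x n ^+ 2).
  rewrite -subr_ge0.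
  have -> : b * m n ^+ 2 + c * ((1 - b) * x n ^+ 2)
      - (a * m n + (1 - a) * x n) ^+ 2
    = ((b - a ^+ 2) * m n - a * (1 - a) * x n) ^+ 2 / (b - a ^+ 2).
    by rewrite /c; field; rewrite ?nn.
  by rewrite divr_ge0 ?sqr_ge0// ltW.
apply: (le_trans step); by rewrite lerD2r (mulrCA c) ler_pM2l.
Qed.

Lemma second_moment_ge0 (R : realType) (b : R) (x v : nat -> R) :
  0 < b -> b < 1 -> v 0%N = 0 ->
  (forall n, v n.+1 = b * v n + (1 - b) * x n ^+ 2) -> forall n, 0 <= v n.
Proof.
move=> b0 b1 v0 vS; elim=> [|n IH]; first by rewrite v0.
rewrite vS addr_ge0//; apply: mulr_ge0 => //; first exact: ltW.
  by rewrite subr_ge0 ltW.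
exact: sqr_ge0.
Qed.

(** The [l2]-norm of the weighted past is at most its [l1]-norm, whose weights are
the powers of [Num.sqrt b]. *)
Lemma second_moment_le (R : realType) (b : R) (x v : nat -> R) :
  0 < b -> b < 1 -> v 0%N = 0 ->
  (forall n, v n.+1 = b * v n + (1 - b) * x n ^+ 2) ->
  forall n, v n / (1 - b) <= discounted_sum (Num.sqrt b) (fun k => `|x k|) n ^+ 2.
Proof.
move=> b0 b1 v0 vS n; have b10 : 0 < 1 - b by lra.
elim: n => [|n IH]; first by rewrite v0 mul0r sqr_ge0.
rewrite vS /=; set r := discounted_sum _ _ _ in IH *.
have r0 : 0 <= r by apply: discounted_sum_ge0 => //; exact: sqrtr_ge0.
have -> : (b * v n + (1 - b) * x n ^+ 2) / (1 - b)
    = Num.sqrt b ^+ 2 * (v n / (1 - b)) + `|x n| ^+ 2.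
  rewrite sqr_sqrtr ?(ltW b0)// (real_normK (num_real _)); field.
  exact: lt0r_neq0.
rewrite sqrrD exprMn lerD2r (le_trans (ler_wpM2l (sqr_ge0 _) IH))// lerDl.
by rewrite mulrn_wge0// !mulr_ge0// sqrtr_ge0.
Qed.

(** Writing [s] for the bias-corrected root, the error is [m * s / (eps * (s + eps))]
and [`|m|] is at most a multiple of [s], so it is bounded by a multiple of
[tempered_sqr eps s].  Convexity then spreads this bound over the past innovations,
with geometric weights: the contribution of one innovation to the error is at most
linear in its size, however large it is. *)
Lemma adam_direction_linearized (R : realType) (a b eps : R) :
  0 < eps -> a ^+ 2 < b -> b < 1 ->
  exists2 B, 0 < B & forall x m v : nat -> R, m 0%N = 0 -> v 0%N = 0 ->
  (forall n, m n.+1 = a * m n + (1 - a) * x n) ->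
  (forall n, v n.+1 = b * v n + (1 - b) * x n ^+ 2) -> forall n,
   let d := (Num.sqrt (v n.+1 / (1 - b ^+ n.+1)) + eps)^-1 * m n.+1 in
   `|d| <= B /\
   `|m n.+1 / eps - d| <= B / eps * discounted_sum (Num.sqrt b)
           (fun k => tempered_sqr ((1 - Num.sqrt b) * eps) (x k)) n.+1.
Proof.
move=> e0 ab b1.
have b0 : 0 < b by apply: le_lt_trans ab; exact: sqr_ge0.
pose c := (1 - a) ^+ 2 * b / ((b - a ^+ 2) * (1 - b)).
have sb0 : 0 < Num.sqrt b by rewrite sqrtr_gt0.
have sb1 : Num.sqrt b < 1 by rewrite -[ltRHS]sqrtr1 ltr_sqrt.
have c0 : 0 <= c.
  rewrite /c; apply: divr_ge0; apply: mulr_ge0; rewrite ?subr_ge0.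
  - exact: sqr_ge0.
  - exact: ltW.
  - exact: ltW.
  - exact: ltW.
(* one is added only to make the bound positive when [a = 1] *)
exists (Num.sqrt c + 1); first by rewrite ltr_wpDl ?sqrtr_ge0.
move=> x m v m0 v0 mS vS n /=; set s := Num.sqrt (v n.+1 / _).
have vge := second_moment_ge0 b0 b1 v0 vS.
have vle := second_moment_le b0 b1 v0 vS.
have mle : forall k, m k ^+ 2 <= c * v k := momentum_sqr_le ab b1 m0 v0 mS vS.
have bn : 0 < 1 - b ^+ n.+1 by rewrite subr_gt0 exprn_ilt1// ltW.
have s0 : 0 <= s by exact: sqrtr_ge0.
have se : 0 < s + eps by rewrite ltr_wpDl.
have ms : `|m n.+1| <= (Num.sqrt c + 1) * s.
  rewrite -sqrtr_sqr (@le_trans _ _ (Num.sqrt (c * (v n.+1 / (1 - b ^+ n.+1)))))//.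
    rewrite ler_wsqrtr// (le_trans (mle _))// ler_wpM2l//.
    by rewrite ler_pdivlMr// ler_piMr// lerBlDr lerDl exprn_ge0// ltW.
  by rewrite sqrtrM// ler_wpM2r// lerDl.
split.
  rewrite normrM normfV (gtr0_norm se) mulrC ler_pdivrMr// (le_trans ms)//.
  by rewrite ler_wpM2l ?lerDl ?addr_ge0 ?sqrtr_ge0// ltW.
have -> : m n.+1 / eps - (s + eps)^-1 * m n.+1 = m n.+1 * (s / (eps * (s + eps))).
  by field; rewrite ?lt0r_neq0.
set r := fun n => discounted_sum (Num.sqrt b) (fun k => `|x k|) n.
have r0 k : 0 <= r k by apply: discounted_sum_ge0 => //; exact: sqrtr_ge0.
have sr : s <= r n.+1.
  rewrite -(ler_pXn2r (_ : 0 < 2)%N) ?nnegrE// sqr_sqrtr; last by rewrite divr_ge0 ?vge ?ltW.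
  apply: le_trans (vle n.+1); rewrite ler_wpM2l// lef_pV2 ?posrE//; last by rewrite subr_gt0.
  by rewrite lerD2l lerN2 exprS ler_piMr ?exprn_ile1 ?ltW.
have hq k : tempered_sqr eps (r k)
    <= discounted_sum (Num.sqrt b) (fun k => tempered_sqr ((1 - Num.sqrt b) * eps) (x k)) k.
  elim: k => [|k IH]; first by rewrite /tempered_sqr expr0n mul0r.
  rewrite /= (le_trans (tempered_sqr_add_le _ _ _ _ _))//.
  by rewrite lerD// ?ler_pM2l// /tempered_sqr normr_id (real_normK (num_real _)).
have se0 : 0 <= s / (eps * (s + eps)) by rewrite divr_ge0 ?mulr_ge0 ?(ltW e0) ?(ltW se).
rewrite normrM [X in _ * X]ger0_norm//.
apply: (@le_trans _ _ ((Num.sqrt c + 1) / eps * tempered_sqr eps s)).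
  rewrite /tempered_sqr (ger0_norm s0).
  have -> : (Num.sqrt c + 1) / eps * (s ^+ 2 / (s + eps))
     = (Num.sqrt c + 1) * s * (s / (eps * (s + eps))).
    by field; rewrite ?lt0r_neq0.
  by rewrite ler_wpM2r.
rewrite ler_wpM2l ?divr_ge0 ?addr_ge0 ?sqrtr_ge0 ?(ltW e0)//.
exact: le_trans (tempered_sqr_mono e0 s0 sr) (hq _).
Qed.

(** * Weighted sums of momenta *)

Lemma momentum_le (R : realType) (a A s : R) (gamma x m : nat -> R) :
  0 <= a -> a < 1 -> s <= 1 -> 0 <= A ->
  (forall n, (0 < n)%N -> 0 < gamma n) ->
  (forall n k, (0 < n)%N -> (n <= k)%N -> gamma k <= gamma n) ->
  m 0%N = 0 -> (forall n, m n.+1 = a * m n + (1 - a) * x n) ->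
  (forall n, `|x n| <= A * gamma n.+1 `^ (s - 1)) ->
  forall n, (0 < n)%N -> `|m n| <= A * gamma n `^ (s - 1).
Proof.
move=> a0 a1 s1 A0 gpos gdecr m0 mS xle n n0.
have a10 : 0 <= 1 - a by lra.
elim: n n0 => [//|n IH] _.
rewrite mS (le_trans (ler_normD _ _))// !normrM (ger0_norm a0) (ger0_norm a10).
have -> : A * gamma n.+1 `^ (s - 1)
   = a * (A * gamma n.+1 `^ (s - 1)) + (1 - a) * (A * gamma n.+1 `^ (s - 1)) by ring.
rewrite lerD ?ler_wpM2l//.
case: n IH => [_|n IH]; first by rewrite m0 normr0 mulr_ge0 ?powR_ge0.
apply: (le_trans (IH isT)); apply: ler_wpM2l => //.
have -> : s - 1 = - (1 - s) by ring.
rewrite !powRN lef_pV2 ?posrE ?powR_gt0 ?gpos//.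
by apply: ge0_ler_powR; rewrite ?nnegrE ?subr_ge0 ?(ltW (gpos _ _)) ?gdecr.
Qed.

(** Since [m k.+1 - x k] is proportional to [m k - m k.+1], the sum telescopes up to
the variation of the weights; the bound is [O(gamma n ^ s)] uniformly in [N]. *)
Lemma momentum_sum_error (R : realType) (a A s : R) (gamma x m : nat -> R) :
  0 <= a -> a < 1 -> 0 < s <= 1 -> 0 <= A ->
  (forall n, (0 < n)%N -> 0 < gamma n) ->
  (forall n k, (0 < n)%N -> (n <= k)%N -> gamma k <= gamma n) ->
  m 0%N = 0 -> (forall n, m n.+1 = a * m n + (1 - a) * x n) ->
  (forall n, `|x n| <= A * gamma n.+1 `^ (s - 1)) ->
  forall n N, (0 < n)%N -> (n <= N)%N ->
  `|\sum_(n <= k < N) gamma k.+1 * (m k.+1 - x k)|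
     <= a / (1 - a) * A * (2 + s^-1) * gamma n `^ s.
Proof.
move=> a0 a1 /andP[s0 s1] A0 gpos gdecr m0 mS xle n N n0 nN.
have mle := momentum_le a0 a1 s1 A0 gpos gdecr m0 mS xle.
have a10 : 0 < 1 - a by lra.
have gm k : (0 < k)%N -> `|gamma k * m k| <= A * gamma k `^ s.
  move=> k0; rewrite normrM gtr0_norm ?gpos//.
  have -> : gamma k `^ s = gamma k * gamma k `^ (s - 1).
    by rewrite -{2}[gamma k](powRr1 (ltW (gpos k k0))) -powRD ?gt_eqF ?gpos ?implybT// addrC subrK.
  by rewrite mulrCA ler_pM2l ?gpos// mle.
(* summation by parts: the weights [gamma k.+1] telescope up to their
   variation, which is paid for by the growth bound on [m] *)
have key M : (n <= M)%N ->
    `|\sum_(n <= k < M) gamma k.+1 * (m k - m k.+1) - gamma n * m n + gamma M * m M|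
      <= A * s^-1 * (gamma n `^ s - gamma M `^ s).
  elim: M => [|M IH] nM.
    by move: nM; rewrite leqNgt n0.
  move: nM; rewrite leq_eqVlt => /predU1P[<-|].
    by rewrite big_geq// sub0r addNr normr0 subrr mulr0.
  rewrite ltnS => nM.
  rewrite big_nat_recr//=.
  have M0 : (0 < M)%N by exact: leq_trans nM.
  set S := \sum_(_ <= _ < _) _ in IH *.
  have -> : S + gamma M.+1 * (m M - m M.+1) - gamma n * m n + gamma M.+1 * m M.+1
     = (S - gamma n * m n + gamma M * m M) - (gamma M - gamma M.+1) * m M by ring.
  apply: (le_trans (ler_normB _ _)).
  have -> : gamma n `^ s - gamma M.+1 `^ s
     = (gamma n `^ s - gamma M `^ s) + (gamma M `^ s - gamma M.+1 `^ s) by ring.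
  rewrite mulrDr lerD ?IH// normrM ger0_norm ?subr_ge0 ?gdecr//.
  apply: (le_trans (ler_wpM2l _ (mle M M0))); first by rewrite subr_ge0 gdecr.
  rewrite mulrCA -mulrA ler_wpM2l//.
  by apply: powR_sub_ge; rewrite ?gpos ?gdecr// s0.
have -> : \sum_(n <= k < N) gamma k.+1 * (m k.+1 - x k)
    = a / (1 - a) * \sum_(n <= k < N) gamma k.+1 * (m k - m k.+1).
  rewrite mulr_sumr; apply: eq_bigr => k _.
  have -> : x k = (m k.+1 - a * m k) / (1 - a).
    by rewrite mS; field; exact: lt0r_neq0.
  by field; exact: lt0r_neq0.
rewrite normrM ger0_norm ?divr_ge0 ?(ltW a10)// -!mulrA.
apply: ler_wpM2l => //; apply: ler_wpM2l; first by rewrite invr_ge0 ltW.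
set S := \sum_(_ <= _ < _) _ in key *.
have N0 : (0 < N)%N by exact: leq_trans nN.
have -> : S = (S - gamma n * m n + gamma N * m N) + gamma n * m n - gamma N * m N by ring.
apply: (le_trans (ler_normB _ _)).
apply: (le_trans (lerD (ler_normD _ _) (le_refl _))).
have gN : gamma N `^ s <= gamma n `^ s.
  by apply: ge0_ler_powR; rewrite ?nnegrE ?(ltW (gpos _ _)) ?gdecr ?ltW.
have := key N nN; have := gm n n0; have := gm N N0.
have sV : 0 < s^-1 by rewrite invr_gt0.
have := powR_ge0 (gamma N) s; have := powR_ge0 (gamma n) s.
have := ler_wpM2l A0 gN.
have := mulr_ge0 (mulr_ge0 A0 (ltW sV)) (powR_ge0 (gamma N) s).
have -> : A * ((2 + s^-1) * gamma n `^ s) = 2 * (A * gamma n `^ s) + A * s^-1 * gamma n `^ s by ring.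
lra.
Qed.

Lemma discounted_sum_le (R : realType) (b A s : R) (gamma y : nat -> R) :
  0 <= b -> b < 1 -> s <= 1 -> 0 <= A ->
  (forall n, (0 < n)%N -> 0 < gamma n) ->
  (forall n k, (0 < n)%N -> (n <= k)%N -> gamma k <= gamma n) ->
  (forall n, 0 <= y n <= A * gamma n.+1 `^ (s - 1)) ->
  forall n, (0 < n)%N ->
    discounted_sum b y n <= A / (1 - b) * gamma n `^ (s - 1).
Proof.
move=> b0 b1 s1 A0 gpos gdecr yle n n0.
have b10 : 0 < 1 - b by lra.
pose x k := y k; pose m k := (1 - b) * discounted_sum b y k.
have xle k : `|x k| <= A * gamma k.+1 `^ (s - 1).
  by have /andP[y0 yk] := yle k; rewrite ger0_norm.
have mS k : m k.+1 = b * m k + (1 - b) * x k by rewrite /m /= /x; ring.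
have := momentum_le b0 b1 s1 A0 gpos gdecr (mulr0 _ : m 0%N = 0) mS xle n0.
move=> /(le_trans (ler_norm _)).
by rewrite /m mulrAC ler_pdivlMr// mulrC.
Qed.

(** The kernel of a discounted sum has mass [(1 - b)^-1], and decreasing weights can only
help; the boundary term is what the past of [n] contributes. *)
Lemma discounted_weighted_sum (R : realType) (b A s : R) (gamma y : nat -> R) :
  0 <= b -> b < 1 -> 0 < s <= 1 -> 0 <= A ->
  (forall n, (0 < n)%N -> 0 < gamma n) ->
  (forall n k, (0 < n)%N -> (n <= k)%N -> gamma k <= gamma n) ->
  (forall n, 0 <= y n <= A * gamma n.+1 `^ (s - 1)) ->
  forall n N, (0 < n)%N -> (n <= N)%N ->
  (1 - b) * \sum_(n <= k < N) gamma k.+1 * discounted_sum b y k.+1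
    <= \sum_(n <= k < N) gamma k.+1 * y k + A / (1 - b) * gamma n `^ s.
Proof.
move=> b0 b1 /andP[s0 s1] A0 gpos gdecr yle n N n0 nN.
have qle := discounted_sum_le b0 b1 s1 A0 gpos gdecr yle n0.
set q := discounted_sum b y.
have q0 k : 0 <= q k by apply: discounted_sum_ge0 => // j; have /andP[] := yle j.
have b10 : 0 < 1 - b by lra.
have start : gamma n * q n <= A / (1 - b) * gamma n `^ s.
  have -> : gamma n `^ s = gamma n * gamma n `^ (s - 1).
    by rewrite -{2}[gamma n](powRr1 (ltW (gpos n n0))) -powRD ?gt_eqF ?gpos ?implybT// addrC subrK.
  by rewrite mulrCA ler_pM2l ?gpos.
suff H : (1 - b) * (\sum_(n <= k < N) gamma k.+1 * q k.+1) + b * (gamma N * q N)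
    <= \sum_(n <= k < N) gamma k.+1 * y k + b * (gamma n * q n).
  have := mulr_ge0 b0 (mulr_ge0 (ltW (gpos N (leq_trans n0 nN))) (q0 N)).
  have : b * (gamma n * q n) <= 1 * (gamma n * q n).
    by rewrite ler_wpM2r ?mulr_ge0 ?q0 ?(ltW (gpos _ _)) ?ltW.
  lra.
elim: N nN => [|N IH] nN.
  by move: nN; rewrite leqNgt n0.
move: nN; rewrite leq_eqVlt => /predU1P[<-|].
  by rewrite !big_geq// mulr0.
rewrite ltnS => nN; rewrite !big_nat_recr//=.
have := IH nN; set S1 := \sum_(_ <= _ < _) _; set S2 := \sum_(_ <= _ < _) _ => {IH}IH.
have N0 : (0 < N)%N by exact: leq_trans nN.
have E : q N.+1 = b * q N + y N by [].
have : b * (gamma N.+1 * q N) <= b * (gamma N * q N).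
  by rewrite ler_wpM2l// ler_wpM2r ?gdecr.
have -> : (1 - b) * (S1 + gamma N.+1 * (b * q N + y N)) + b * (gamma N.+1 * (b * q N + y N))
   = (1 - b) * S1 + b * (gamma N.+1 * q N) + gamma N.+1 * y N by ring.
lra.
Qed.

(** * Independence of the past *)

(** The cylinders over [Us 1, ..., Us n]: a pi-system that generates the information
available after [n] steps. *)
Definition history (Omega : Type) (dS : measure_display)
  (S : measurableType dS) (Us : nat -> Omega -> S) (n : nat) : set (set Omega) :=
  [set E | exists2 A : nat -> set S, (forall k, measurable (A k)) &
     E = \bigcap_(k in [set k | (0 < k <= n)%N]) (Us k @^-1` A k)].

(** The sample space with the coarser sigma-algebra of the past: measurability on
it is adaptedness. *)
Notation past Us n := (g_sigma_algebraType (history Us n)).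

Lemma history_setI_closed (Omega : Type) (dS : measure_display)
  (S : measurableType dS) (Us : nat -> Omega -> S) (n : nat) :
  setI_closed (history Us n).
Proof.
move=> _ _ [A mA ->] [B mB ->]; exists (fun k => A k `&` B k).
  by move=> k; exact: measurableI.
rewrite predeqE => w; split=> [[wA wB] k kn|wAB].
  by split; [exact: wA|exact: wB].
by split=> k kn; have [] := wAB k kn.
Qed.

Lemma historyT (Omega : Type) (dS : measure_display)
  (S : measurableType dS) (Us : nat -> Omega -> S) (n : nat) :
  history Us n setT.
Proof.
by exists (fun=> setT) => //; rewrite predeqE => w; split.
Qed.

Lemma history_mono (Omega : Type) (dS : measure_display)
  (S : measurableType dS) (Us : nat -> Omega -> S) (n : nat) :
  history Us n `<=` history Us n.+1.
Proof.
move=> _ [A mA ->]; exists (fun k => if (k <= n)%N then A k else setT).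
  by move=> k; case: ifP.
rewrite predeqE => w; split=> wA k /=.
  move=> /andP[k0 kn]; case: ifPn => // kn'.
  by apply: wA; rewrite /= k0.
move=> /andP[k0 kn]; have := wA k; rewrite /= kn k0 (leq_trans kn)//.
exact.
Qed.

Lemma history_preimage (Omega : Type) (dS : measure_display)
  (S : measurableType dS) (Us : nat -> Omega -> S) (n k : nat) (A : set S) :
  (0 < k <= n)%N -> measurable A -> history Us n (Us k @^-1` A).
Proof.
move=> kn mA; exists (fun j => if j == k then A else setT).
  by move=> j; case: ifP.
rewrite predeqE => w; split=> [wA j _ /=|/(_ k kn)]; rewrite /preimage/=.
  by case: eqP => [->|].
by rewrite eqxx.
Qed.

Lemma history_measurable (dO dS : measure_display) (Omega : measurableType dO)
  (S : measurableType dS) (Us : nat -> Omega -> S) (n : nat) :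
  (forall k, measurable_fun [set: Omega] (Us k)) ->
  history Us n `<=` @measurable _ Omega.
Proof.
move=> mU _ [A mA ->]; apply: bigcap_measurableType => k _.
by rewrite -[X in measurable X]setTI; exact: mU.
Qed.

Lemma measurable_fun_to_past (dO dS : measure_display) (Omega : measurableType dO)
  (S : measurableType dS) (Us : nat -> Omega -> S) (n : nat) :
  (forall k, measurable_fun [set: Omega] (Us k)) ->
  measurable_fun [set: Omega] (fun w => w : past Us n).
Proof.
move=> mU _ B mB; rewrite setTI preimage_id.
apply: (smallest_sub (@sigma_algebra_measurable _ Omega) _ mB).
exact: history_measurable.
Qed.

Lemma measurable_fun_past_mono (dO dS d : measure_display) (Omega : measurableType dO)
  (S : measurableType dS) (T : measurableType d) (Us : nat -> Omega -> S) (n : nat)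
  (f : Omega -> T) :
  measurable_fun [set: past Us n] (f : past Us n -> T) ->
  measurable_fun [set: past Us n.+1] (f : past Us n.+1 -> T).
Proof.
move=> mf _ B mB; have := mf measurableT B mB.
apply: smallest_sub.
  exact: (@sigma_algebra_measurable _ (past Us n.+1)).
by move=> E /history_mono; exact: sub_sigma_algebra.
Qed.

Lemma measurable_fun_past_proj (dO dS : measure_display) (Omega : measurableType dO)
  (S : measurableType dS) (Us : nat -> Omega -> S) (n k : nat) :
  (0 < k <= n)%N -> measurable_fun [set: past Us n] (Us k : past Us n -> S).
Proof.
move=> kn _ B mB; rewrite setTI; apply: sub_sigma_algebra.
exact: history_preimage.
Qed.

(** Both sides are finite measures in [E] that agree on cylinders by the product
rule. *)
Lemma past_independent (dO dS : measure_display)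
    (Omega : measurableType dO) (S : measurableType dS) (R : realType)
    (P : probability Omega R) (Us : nat -> {RV P >-> S}) n :
  mutually_independent [set n | (0 < n)%N] Us ->
  forall (E : set Omega) (B : set S),
    <<s history (fun k => Us k) n >> E -> measurable B ->
    P (E `&` Us n.+1 @^-1` B) = (P E * P (Us n.+1 @^-1` B))%E.
Proof.
move=> indep E B sE mB.
have mU k : measurable_fun [set: Omega] (Us k) by [].
have mUB : measurable (Us n.+1 @^-1` B) by rewrite -[X in measurable X]setTI; exact: mU.
have Pfin : P (Us n.+1 @^-1` B) \is a fin_num by exact: fin_num_measure.
have r0 : (0 <= fine (P (Us n.+1 @^-1` B)))%R by rewrite fine_ge0.
pose r := NngNum r0.
have rE : (r%:num)%:E = P (Us n.+1 @^-1` B) by rewrite -[RHS]fineK.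
have scE F : mscale r P F = (P F * P (Us n.+1 @^-1` B))%E.
  by rewrite muleC -rE.
rewrite -[RHS]scE.
apply: (@g_sigma_algebra_measure_unique _ _ _ (history (fun k => Us k) n) _ (fun=> setT) _ _
  (mrestr P mUB : {measure set Omega -> \bar R}) (mscale r P : {measure set Omega -> \bar R})) => //.
- by apply: history_measurable.
- by move=> _; exact: historyT.
- by rewrite bigcup_const.
- exact: history_setI_closed.
- move=> _ [A mA ->]; rewrite [RHS]scE; transitivity (P (\bigcap_(k in [set k | (0 < k <= n)%N]) (Us k @^-1` A k) `&` Us n.+1 @^-1` B)) => //.
  (* the product rule is applied to [1, ..., n] and to [1, ..., n.+1] *)
  pose A' k := if k == n.+1 then B else A k.
  have mA' k : measurable (A' k) by rewrite /A'; case: ifP.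
  pose J : {fset nat} := [fset k in iota 1 n]%fset.
  have JE k : (k \in J) = (0 < k <= n)%N by rewrite !inE mem_iota add1n ltnS.
  pose J1 : {fset nat} := (n.+1 |` J)%fset.
  have nJ : n.+1 \notin J by rewrite JE ltnn andbF.
  have EJ : \bigcap_(k in [set k | (0 < k <= n)%N]) (Us k @^-1` A k)
      = \bigcap_(k in [set` J]) (Us k @^-1` A k).
    by apply: eq_bigcapl; split=> k /=; rewrite JE.
  have EJ1 : \bigcap_(k in [set k | (0 < k <= n)%N]) (Us k @^-1` A k) `&` Us n.+1 @^-1` B
      = \bigcap_(k in [set` J1]) (Us k @^-1` A' k).
    rewrite EJ predeqE => w; split=> [[wA wB] k /=|wA].
      rewrite /J1 /A' in_fset1U => /orP[/eqP ->|kJ]; first by rewrite eqxx.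
      case: eqP => [->//|_]. exact: wA.
    split=> [k kJ|].
      have := wA k; rewrite /A' /J1 /= in_fset1U.
      rewrite /= in kJ; rewrite kJ orbT => /(_ isT).
      by case: eqP => // kn; rewrite kn (negbTE nJ) in kJ.
    by have := wA n.+1; rewrite /A' /J1 /= in_fset1U eqxx; exact.
  rewrite EJ1 indep//; last first.
    by move=> k; rewrite /J1 /= in_fset1U JE => /orP[/eqP ->|/andP[]].
  rewrite EJ indep//; last by move=> k /=; rewrite JE => /andP[].
  rewrite big_fsetU1//= {1}/A' eqxx muleC; congr (_ * _)%E.
  rewrite big_seq [RHS]big_seq; apply: eq_bigr => k kJ; rewrite /A'.
  by case: eqP => // kn; rewrite kn (negbTE nJ) in kJ.
- move=> k; apply: (@le_lt_trans _ _ (P setT)); last by rewrite probability_setT ltry.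
  by apply: le_measure; rewrite ?inE//; exact: measurableI.
Qed.

(** Stands for the conditional expectation given the past: the joint law of the
identity into [past Us n] and of [Us n.+1] is a product, so the fresh variable may be
replaced by an independent copy while the past is frozen. *)
Lemma freezing (dO dS : measure_display)
    (Omega : measurableType dO) (S : measurableType dS) (R : realType)
    (P : probability Omega R) (U : {RV P >-> S}) (Us : nat -> {RV P >-> S}) n :
  iid_copies U Us ->
  forall g : past (fun k => Us k) n * S -> \bar R,
  measurable_fun setT g -> (forall z, 0 <= g z)%E ->
  (\int[P]_w g (w, Us n.+1 w) = \int[P]_w \int[P]_w' g (w, U w'))%E.
Proof.
move=> [eqU indep] g mg g0.
have mU k : measurable_fun [set: Omega] (Us k) by [].
pose T : measurableType _ := past (fun k => Us k) n.
have mid : measurable_fun [set: Omega] (fun w => w : T) by exact: measurable_fun_to_past.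
have mpair : measurable_fun [set: Omega] (fun w => ((w : T), Us n.+1 w)).
  by apply: measurable_fun_pair.
pose idm_mix := isMeasurableFun.Build _ _ _ _ _ mid.
pose idm : {mfun Omega >-> T} := HB.pack (fun w : Omega => w : T) idm_mix.
pose pr_mix := isMeasurableFun.Build _ _ _ _ _ mpair.
pose pr : {mfun Omega >-> (T * S)%type} := HB.pack (fun w : Omega => ((w : T), Us n.+1 w)) pr_mix.
have E A : measurable A -> (distribution P idm \x distribution P U)%E A = distribution P pr A.
  move=> mA; apply: product_measure_unique => // B D mB mD.
  transitivity (P B * P (Us n.+1 @^-1` D))%E; first exact: (past_independent indep).
  congr (_ * _)%E; exact: (eqU n.+1 isT D mD).
transitivity (\int[distribution P pr]_z g z)%E.
  by rewrite ge0_integral_distribution.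
transitivity (\int[distribution P idm \x distribution P U]_z g z)%E.
  by apply: eq_measure_integral => A mA _; apply/esym; exact: E.
rewrite (fubini_tonelli1 g)//.
rewrite ge0_integral_distribution//; first last.
- by move=> w; apply: integral_ge0.
- exact: measurable_fun_fubini_tonelli_F.
apply: eq_integral => w _.
rewrite /= /fubini_F ge0_integral_distribution//.
by apply: measurableT_comp => //; exact: pair1_measurable.
Qed.

(** * Borel structure and adaptedness of the iterates *)

Lemma measurable_borelRV (R : realType) (d : nat) (g : 'rV[R]_d -> R) :
  continuous g -> measurable_fun [set: borelRV R d] (g : borelRV R d -> R).
Proof.
move=> /continuousP cg; apply: (measurability _ (RGenOpens.measurableE R)).
move=> _ [_ [a [b ->] <-]]; rewrite setTI; apply: sub_sigma_algebra.
exact/cg/interval_open.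
Qed.

(** Open sets are countable unions of boxes with rational centres and sizes. *)
Lemma measurable_fun_borelRV (R : realType) (d : nat) (dT : measure_display)
    (T : measurableType dT) (f : T -> 'rV[R]_d) :
  (forall i, measurable_fun [set: T] (fun t => f t ord0 i)) ->
  measurable_fun [set: T] (f : T -> borelRV R d).
Proof.
move=> mf; apply: (@measurability _ _ T (borelRV R d) setT f (@open 'rV[R]_d)) => //.
move=> _ [W oW <-]; rewrite setTI.
pose box (q : 'rV[rat]_d * rat) : set 'rV[R]_d :=
  [set x | forall i, `|x ord0 i - ratr (q.1 ord0 i)| < ratr q.2].
have -> : f @^-1` W = \bigcup_q (if `[< box q `<=` W >] then f @^-1` box q else set0).
  rewrite predeqE => t; split=> [Wft|[q _]]; last first.
    by case: asboolP => // qW bq; exact: qW.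
  have /nbhs_ballP[e /= e0 eW] : nbhs (f t) W by exact: open_nbhs_nbhs.
  have e20 : 0 < e / 2 by rewrite divr_gt0.
  have [r] := rat_in_itvoo e20.
  rewrite in_itv/= => /andP[r0 re].
  have cex i : exists c : rat, `|f t ord0 i - ratr c| < ratr r.
    have : f t ord0 i - ratr r < f t ord0 i + ratr r by lra.
    move=> /rat_in_itvoo[c]; rewrite in_itv/= => /andP[c1 c2]; exists c.
    by rewrite ltr_norml; apply/andP; split; lra.
  have [c cP] := choice cex.
  exists (\row_i c i, r) => //; case: asboolP => [_ i /=|]; first by rewrite mxE.
  move=> nb; exfalso; apply: nb => y yb; apply: eW; split=> [//|i j]; rewrite ord1 /ball/=.
  have := yb j; have := cP j; rewrite /= mxE !ltr_norml => /andP[? ?] /andP[? ?].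
  by apply/andP; split; lra.
apply: countable_bigcupT_measurable; first exact: countableP.
move=> q; case: asboolP => // _.
have -> : f @^-1` box q = \bigcap_(i : 'I_d) [set t | `|f t ord0 i - ratr (q.1 ord0 i)| < ratr q.2].
  by rewrite predeqE => t; split=> [tq i _|tq i]; [exact: tq|exact: (tq i)].
apply: fin_bigcap_measurable => // i _.
have -> : [set t | `|f t ord0 i - ratr (q.1 ord0 i)| < ratr q.2]
    = [set: T] `&` (fun t => f t ord0 i) @^-1`
       `]ratr (q.1 ord0 i) - ratr q.2, ratr (q.1 ord0 i) + ratr q.2[.
  by rewrite setTI predeqE => t; rewrite /= in_itv/= ltr_distl.
exact: mf.
Qed.

Lemma adam_measurable (dO dS : measure_display)
    (Omega : measurableType dO) (S : measurableType dS) (R : realType) (d : nat)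
    (X : S -> 'rV[R]_d -> 'rV[R]_d) (gamma : nat -> R) (alpha beta eps : R)
    (x0 : 'rV[R]_d) (Us : nat -> Omega -> S)
    (theta m v sigma : nat -> Omega -> 'rV[R]_d) :
  product_measurable X -> 0 < eps ->
  (forall w, [/\ theta 0%N w = x0, m 0%N w = 0 & v 0%N w = 0]) ->
  (forall (n : nat) (w : Omega) (j : 'I_d),
        let G := X (Us n.+1 w) (theta n w) in
        [/\ m n.+1 w ord0 j =
              alpha * m n w ord0 j + (1 - alpha) * G ord0 j,
            v n.+1 w ord0 j =
              beta * v n w ord0 j + (1 - beta) * (G ord0 j) ^+ 2,
            sigma n.+1 w ord0 j =
              (Num.sqrt (v n.+1 w ord0 j / (1 - beta ^+ n.+1)) + eps)^-1 &
            theta n.+1 w ord0 j =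
              theta n w ord0 j
              + gamma n.+1 * sigma n.+1 w ord0 j * m n.+1 w ord0 j]) ->
  forall n, measurable_fun [set: past Us n] (theta n : past Us n -> borelRV R d).
Proof.
move=> mX e0 init step.
suff H n : [/\ measurable_fun [set: past Us n] (theta n : past Us n -> borelRV R d),
    (forall j, measurable_fun [set: past Us n] (fun w : past Us n => m n w ord0 j)) &
    (forall j, measurable_fun [set: past Us n] (fun w : past Us n => v n w ord0 j))].
  by move=> n; have [] := H n.
elim: n => [|n [IHt IHm IHv]].
  split.
  - have -> : theta 0%N = cst x0 by apply/funext => w; have [] := init w.
    exact: measurable_cst.
  - move=> j; have -> : m 0%N = cst 0 by apply/funext => w; have [] := init w.
    exact: measurable_cst.
  - move=> j; have -> : v 0%N = cst 0 by apply/funext => w; have [] := init w.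
    exact: measurable_cst.
have mt := measurable_fun_past_mono IHt.
have mm j := measurable_fun_past_mono (IHm j).
have mv j := measurable_fun_past_mono (IHv j).
have mU : measurable_fun [set: past Us n.+1] (Us n.+1 : past Us n.+1 -> S).
  by apply: measurable_fun_past_proj; rewrite leqnn.
have mcoord j : measurable_fun [set: borelRV R d] (fun x : borelRV R d => (x : 'rV[R]_d) ord0 j).
  by apply: measurable_borelRV => x; exact: coord_continuous.
have mG j : measurable_fun [set: past Us n.+1]
    (fun w : past Us n.+1 => X (Us n.+1 w) (theta n w) ord0 j).
  apply: (measurableT_comp (mcoord j)).
  exact: (measurableT_comp mX (measurable_fun_pair mU mt)).
have mm' j : measurable_fun [set: past Us n.+1] (fun w : past Us n.+1 => m n.+1 w ord0 j).
  rewrite (_ : (fun _ => _) = (fun w => alpha * m n w ord0 j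
      + (1 - alpha) * X (Us n.+1 w) (theta n w) ord0 j)); last first.
    by apply/funext => w; have [] := step n w j.
  by apply: measurable_funD; apply: measurable_funM.
have mv' j : measurable_fun [set: past Us n.+1] (fun w : past Us n.+1 => v n.+1 w ord0 j).
  rewrite (_ : (fun _ => _) = (fun w => beta * v n w ord0 j
      + (1 - beta) * X (Us n.+1 w) (theta n w) ord0 j ^+ 2)); last first.
    by apply/funext => w; have [] := step n w j.
  by apply: measurable_funD; apply: measurable_funM => //; exact: measurable_funX.
split=> //; apply: measurable_fun_borelRV => j.
rewrite (_ : (fun _ => _) = (fun w => theta n w ord0 j + gamma n.+1 *
    ((Num.sqrt (v n.+1 w ord0 j / (1 - beta ^+ n.+1)) + eps) `^ (-1))
     * m n.+1 w ord0 j)); last first.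
  apply/funext => w; have [_ _ s t] := step n w j.
  by rewrite t s powR_inv1// addr_ge0 ?sqrtr_ge0// ltW.
apply: measurable_funD; first exact: measurableT_comp (mcoord j) mt.
apply: measurable_funM => //; apply: measurable_funM => //.
apply: (measurableT_comp (measurable_powR (-1))).
apply: measurable_funD => //.
apply: (measurableT_comp (f := @Num.sqrt R)); last by apply: measurable_funM.
apply: continuous_measurable_fun. exact: sqrt_continuous.
Qed.

(** * A maximal inequality *)

Lemma expectation_freezing_le (dO dS : measure_display)
    (Omega : measurableType dO) (S : measurableType dS) (R : realType)
    (P : probability Omega R) (U : {RV P >-> S}) (Us : nat -> {RV P >-> S}) n
    (g : past (fun k => Us k) n * S -> \bar R) (b : Omega -> \bar R) :
  iid_copies U Us ->
  measurable_fun setT g -> (forall z, 0 <= g z)%E ->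
  measurable_fun setT b ->
  (forall w, \int[P]_w' g (w, U w') <= b w)%E ->
  (\int[P]_w g (w, Us n.+1 w) <= \int[P]_w b w)%E.
Proof.
move=> iid mg g0 mb gb; rewrite (freezing iid mg g0).
have mU k : measurable_fun [set: Omega] (Us k) by [].
apply: ge0_le_integral => //.
- by move=> w _; apply: integral_ge0.
- have mid := measurable_fun_to_past (n := n) mU.
  have mF := @measurable_fun_fubini_tonelli_F _ _ _ _ _ (distribution P U) g mg g0.
  have := measurableT_comp mF mid.
  apply: eq_measurable_fun => w _ /=; rewrite /fubini_F ge0_integral_distribution//.
  by apply: measurableT_comp => //; exact: pair1_measurable.
Qed.

(** Partial sums frozen as soon as they reach the level [a], so that having reached it
by a given time is a property of the last value. *)
Fixpoint stopped_sum (R : realType) (a : R) (psi : nat -> R) (i : nat) : R :=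
  if i is i'.+1 then
    if a <= stopped_sum a psi i' then stopped_sum a psi i'
    else stopped_sum a psi i' + psi i'
  else 0.

Lemma stopped_sum_ge (R : realType) (a : R) (psi : nat -> R) i :
  a <= \sum_(k < i) psi k -> a <= stopped_sum a psi i.
Proof.
suff : stopped_sum a psi i = \sum_(k < i) psi k \/ a <= stopped_sum a psi i.
  by case=> [->|].
elim: i => [|i [IH|IH]] /=; first by left; rewrite big_ord0.
- by case: ifP => [|_]; [right|left; rewrite big_ord_recr /= IH].
- by rewrite IH; right.
Qed.

(** Ville's inequality.  The exponential of the stopped sums has expectation at most
one at every time by [freezing], and Markov's inequality at one time controls the
maximum up to that time. *)
Lemma maximal_inequality (dO dS : measure_display)
    (Omega : measurableType dO) (S : measurableType dS) (R : realType)
    (P : probability Omega R) (U : {RV P >-> S}) (Us : nat -> {RV P >-> S})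
    (d : nat) (theta : nat -> Omega -> 'rV[R]_d)
    (psi : nat -> S -> 'rV[R]_d -> R) (n : nat) (a : R) :
  iid_copies U Us ->
  (forall n, measurable_fun [set: past (fun k => Us k) n]
      (theta n : past (fun k => Us k) n -> borelRV R d)) ->
  (forall k, measurable_fun [set: S * borelRV R d]
      (fun z : S * borelRV R d => psi k z.1 z.2)) ->
  (forall k x, (n <= k)%N -> (\int[P]_w (expR (psi k (U w) x))%:E <= 1)%E) ->
  exists E : set Omega, [/\ measurable E,
    (P E <= (expR (- a))%:E)%E &
    forall w N, (n <= N)%N ->
      a <= \sum_(n <= k < N) psi k (Us k.+1 w) (theta k w) -> E w].
Proof.
move=> iid mtheta mpsi psi1.
have mU k : measurable_fun [set: Omega] (Us k) by [].
pose term w i := psi (n + i)%N (Us (n + i).+1 w) (theta (n + i)%N w).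
pose L i w := stopped_sum a (term w) i.
have mpsi' k : measurable_fun setT (fun z : past (fun k => Us k) k * S =>
    psi k z.2 (theta k z.1)).
  apply: (measurableT_comp (mpsi k)
    (g := fun z : past (fun k => Us k) k * S => (z.2, theta k z.1 : borelRV R d))).
  apply: measurable_fun_pair => //=; exact: measurableT_comp.
have mterm i : measurable_fun [set: past (fun k => Us k) (n + i).+1]
    (fun w : past (fun k => Us k) (n + i).+1 => term w i).
  apply: (measurableT_comp (mpsi (n + i)%N)
    (g := fun w : past (fun k => Us k) (n + i).+1 =>
       (Us (n + i).+1 w, theta (n + i)%N w : borelRV R d))).
  apply: measurable_fun_pair => //=.
    by apply: measurable_fun_past_proj; rewrite leqnn.
  exact: measurable_fun_past_mono.
have mL i : measurable_fun [set: past (fun k => Us k) (n + i)]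
    (fun w : past (fun k => Us k) (n + i) => L i w).
  elim: i => [|i IH]; first exact: measurable_cst.
  rewrite addnS; apply: measurable_fun_ifT.
  - by apply: measurable_fun_ler => //; exact: measurable_fun_past_mono.
  - exact: measurable_fun_past_mono.
  - apply: measurable_funD; last exact: mterm.
    exact: measurable_fun_past_mono.
have mLO i : measurable_fun [set: Omega] (L i).
  exact: (measurableT_comp (mL i) (measurable_fun_to_past (n := n + i) mU)).
have EL i : (\int[P]_w (expR (L i w))%:E <= 1)%E.
  elim: i => [|i IH].
    rewrite (eq_integral (cst 1%E)); last by move=> w _; rewrite /L /= expR0.
    by rewrite integral_cst// mul1e; exact: probability_le1.
  apply: le_trans IH.
  pose g0 (z : past (fun k => Us k) (n + i) * S) : R :=
    if a <= L i z.1 then expR (L i z.1)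
    else expR (L i z.1) * expR (psi (n + i)%N z.2 (theta (n + i)%N z.1)).
  pose g := EFin \o g0.
  rewrite (eq_integral (fun w => g (w, Us (n + i).+1 w))); last first.
    move=> w _; rewrite /g /g0 /L /=; case: ifP => // _.
    by rewrite expRD.
  have mL1 : measurable_fun setT (fun z : past (fun k => Us k) (n + i) * S => L i z.1).
    exact: measurableT_comp.
  apply: (expectation_freezing_le iid) => //.
  - apply/measurable_EFinP; apply: measurable_fun_ifT.
    + exact: measurable_fun_ler.
    + exact: measurableT_comp.
    + by apply: measurable_funM; exact: measurableT_comp.
  - by move=> z; rewrite lee_fin /g0; case: ifP => _; rewrite ?mulr_ge0 ?expR_ge0.
  - by apply/measurable_EFinP; exact: measurableT_comp.
  - move=> w; rewrite /g /g0 /=; case: (leP a (L i w)) => _.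
      rewrite integral_cst// [X in (_ * X)%E](_ : _ = 1%E) ?mule1//.
      exact: probability_setT.
    rewrite (eq_integral (fun w' => (expR (L i w))%:E * (expR (psi (n + i)%N (U w') (theta (n + i)%N w)))%:E)%E)//.
    rewrite ge0_integralZl//=; last first.
      apply/measurable_EFinP; apply: measurableT_comp => //.
      apply: (measurableT_comp (mpsi _) (g := fun w' : Omega => (U w', theta (n + i)%N w : borelRV R d))).
      exact: measurable_fun_pair.
    by rewrite -[leRHS]mule1 lee_wpmul2l ?psi1 ?leq_addr.
pose E i := [set w | a <= L i w].
have mE i : measurable (E i).
  rewrite -[X in measurable X]setTI.
  exact: (measurable_fun_ler (measurable_cst _) (mLO i) measurableT (Y := [set true])).
have PE i : (P (E i) <= (expR (- a))%:E)%E.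
  rewrite expRN -[leRHS]mul1e lee_pdivlMr ?expR_gt0//.
  apply: le_trans (EL i).
  rewrite muleC -integral_cst//.
  apply: (@le_trans _ _ (\int[P]_(w in E i) (expR (L i w))%:E)%E).
    apply: ge0_le_integral => //.
    - by move=> w _; rewrite lee_fin expR_ge0.
    - by apply/measurable_EFinP; apply: measurableT_comp => //; exact: measurable_funTS.
    - by move=> w /= aL; rewrite lee_fin ler_expR.
  apply: ge0_subset_integral => //.
  by apply/measurable_EFinP; apply: measurableT_comp.
exists (\bigcup_i E i); split; first exact: bigcupT_measurable.
- have nE : nondecreasing_seq E.
    apply/nondecreasing_seqP => i; apply/subsetPset => w; rewrite /E /L /= => aL.
    by rewrite aL.
  have cE := nondecreasing_cvg_mu (mu := P) mE (bigcupT_measurable _ mE) nE.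
  rewrite -(cvg_lim _ cE)//; apply: lime_le; first by apply/cvg_ex; exists (P (\bigcup_i E i)).
  by apply: nearW => i; exact: PE.
- move=> w N nN aS; exists (N - n)%N => //; apply: stopped_sum_ge.
  apply: (le_trans aS); rewrite le_eqVlt; apply/orP; left; apply/eqP.
  rewrite -{1}[n]add0n big_addn big_mkord; apply: eq_bigr => k _.
  by rewrite /term addnC.
Qed.

(** * Moments, tails and truncation *)

Lemma borel_cantelli_ae (d : measure_display) (T : measurableType d) (R : realType)
    (P : probability T R) (E : nat -> set T) (c : nat -> R) :
  (forall n, measurable (E n)) -> (forall n, 0 <= c n) ->
  (forall n, (P (E n) <= (c n)%:E)%E) ->
  (\sum_(n <oo) (c n)%:E < +oo)%E ->
  {ae P, forall w, exists n0, forall n, (n0 <= n)%N -> ~ E n w}.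
Proof.
move=> mE c0 PE csum.
have PS : (\sum_(n <oo) P (E n) < +oo)%E.
  by apply: le_lt_trans csum; apply: lee_nneseries => // n _.
exists (lim_sup_set E); split.
- apply: bigcapT_measurable => k; exact: bigcup_measurable.
- exact: lim_sup_set_cvg0.
- move=> w /= nw n _ /=; apply: contrapT => nE; apply: nw; exists n => k nk Ek.
  by apply: nE; exists k.
Qed.

Lemma sqr_le_1powR (R : realType) (p y : R) :
  2 <= p -> y ^+ 2 <= 1 + `|y| `^ p.
Proof.
move=> p2; rewrite -(real_normK (num_real y)).
have [y1|/ltW y1] := leP `|y| 1.
  apply: (@le_trans _ _ 1); first by rewrite exprn_ile1.
  by rewrite lerDl powR_ge0.
apply: (@le_trans _ _ (`|y| `^ p)); last by rewrite lerDr.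
by rewrite -powR_mulrn//; apply: ler_powR.
Qed.

Lemma integrable_sqr_moment (d : measure_display) (T : measurableType d)
    (R : realType) (P : probability T R) (p V : R) (Y : T -> R) :
  2 <= p -> measurable_fun setT Y ->
  (\int[P]_w (`|Y w| `^ p)%:E <= V%:E)%E ->
  [/\ P.-integrable setT (EFin \o Y),
      P.-integrable setT (EFin \o (fun w => Y w ^+ 2)) &
      (\int[P]_w (Y w ^+ 2)%:E <= (1 + V)%:E)%E].
Proof.
move=> p2 mY YV.
have mYp : measurable_fun setT (fun w => `|Y w| `^ p).
  by apply: (measurableT_comp (measurable_powR p)); exact: measurableT_comp.
have iYp : P.-integrable setT (EFin \o (fun w => `|Y w| `^ p)).
  apply/integrableP; split; first exact/measurable_EFinP.
  rewrite (eq_integral (fun w => (`|Y w| `^ p)%:E)); last first.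
    by move=> w _ /=; rewrite ger0_norm ?powR_ge0.
  by rewrite (le_lt_trans YV)// ltry.
have i1 : P.-integrable setT (EFin \o (fun _ : T => 1 : R)).
  exact: finite_measure_integrable_cst.
have iD : P.-integrable setT (EFin \o (fun w => 1 + `|Y w| `^ p)).
  rewrite (_ : _ \o _ = ((EFin \o (fun _ : T => 1%R : R)) \+ (EFin \o (fun w => (`|Y w| `^ p)%R)))%E); last first.
    by apply/funext => w.
  exact: integrableD.
have mY2 : measurable_fun setT (fun w => Y w ^+ 2) by exact: measurable_funX.
have i2 : P.-integrable setT (EFin \o (fun w => Y w ^+ 2)).
  apply: le_integrable iD => //; first exact/measurable_EFinP.
  move=> w _ /=; rewrite lee_fin [leLHS]ger0_norm ?sqr_ge0// [leRHS]ger0_norm ?addr_ge0 ?powR_ge0//.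
  exact: sqr_le_1powR.
split=> //.
  have i12 : P.-integrable setT (EFin \o (fun w => 1 + Y w ^+ 2)).
    rewrite (_ : _ \o _ = ((EFin \o (fun _ : T => 1%R : R)) \+ (EFin \o (fun w => (Y w ^+ 2)%R)))%E); last first.
      by apply/funext => w.
    exact: integrableD.
  apply: le_integrable i12 => //; first exact/measurable_EFinP.
  move=> w _ /=; rewrite lee_fin [leRHS]ger0_norm ?addr_ge0 ?sqr_ge0//.
  rewrite ler_norml; apply/andP; split; nra.
apply: (@le_trans _ _ (\int[P]_w (1 + `|Y w| `^ p)%:E)%E).
  apply: ge0_le_integral => //.
  - by move=> w _; rewrite lee_fin sqr_ge0.
  - exact/measurable_EFinP.
  - by apply/measurable_EFinP; apply: measurable_funD.
  - by move=> w _; rewrite lee_fin sqr_le_1powR.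
rewrite (eq_integral (fun w => (1%R)%:E + (`|Y w| `^ p)%:E)%E)//.
rewrite integralD// integral_cst// mul1e EFinD leeD//.
exact: probability_le1.
Qed.

(** Truncating only from above can only lower the mean, so [mu] still dominates it and no
bias term appears; [expR_le_quadratic] is one-sided for the same reason. *)
Lemma truncated_mgf_le (d : measure_display) (T : measurableType d)
    (R : realType) (P : probability T R) (p V M mu c : R) (Y : T -> R) :
  2 <= p -> measurable_fun setT Y ->
  (\int[P]_w (`|Y w| `^ p)%:E <= V%:E)%E ->
  (\int[P]_w (Y w)%:E <= mu%:E)%E -> `|mu| <= V ->
  0 <= M -> 0 <= c -> c * (M + V) <= 1 / 2 ->
  (\int[P]_w (expR (c * (Num.min (Y w) M - mu)))%:E
    <= (1 + 4 * c ^+ 2 * (1 + V + V ^+ 2))%:E)%E.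
Proof.
move=> p2 mY YV Ymu muV M0 c0 cM.
have [iY iY2 Y2V] := integrable_sqr_moment p2 mY YV.
pose A := 1 - c * mu + 4 * c ^+ 2 * V ^+ 2.
have V0 : 0 <= V := le_trans (normr_ge0 _) muV.
have pw w : expR (c * (Num.min (Y w) M - mu)) <= A + c * Y w + 4 * c ^+ 2 * Y w ^+ 2.
  set y := Num.min _ _ - mu.
  have yM : y <= M + V.
    have : Num.min (Y w) M <= M by rewrite ge_min lexx orbT.
    move: muV; rewrite ler_norml => /andP[? ?]; rewrite /y; lra.
  have yY : y <= Y w - mu by rewrite lerD2r ge_min lexx.
  have y2 : y ^+ 2 <= 2 * Y w ^+ 2 + 2 * V ^+ 2.
    have mu2 : mu ^+ 2 <= V ^+ 2 by rewrite -(real_normK (num_real mu)) ler_pXn2r.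
    have mY2 : Num.min (Y w) M ^+ 2 <= Y w ^+ 2.
      rewrite minEle; case: ifPn => //; rewrite -ltNge => MY.
      by rewrite ler_pXn2r ?nnegrE ?(ltW MY) ?(le_trans M0 (ltW MY)).
    rewrite /y; move: mY2; set z := Num.min _ _ => mY2.
    have := sqr_ge0 (z + mu); lra.
  apply: (le_trans (expR_le_quadratic _)).
    by apply: le_trans cM; rewrite ler_wpM2l.
  have := ler_wpM2l c0 yY; have := ler_wpM2l (sqr_ge0 c) y2.
  rewrite /A exprMn; lra.
have iA : P.-integrable setT (EFin \o (fun _ : T => A)).
  exact: finite_measure_integrable_cst.
have icY : P.-integrable setT (fun w => c%:E * (Y w)%:E)%E by exact: integrableZl.
have icY2 : P.-integrable setT (fun w => (4 * c ^+ 2)%:E * (Y w ^+ 2)%:E)%E.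
  exact: integrableZl.
have iAY : P.-integrable setT (fun w => A%:E + c%:E * (Y w)%:E)%E.
  exact: (integrableD _ iA icY).
have c20 : 0 <= 4 * c ^+ 2 by rewrite mulr_ge0 ?sqr_ge0.
apply: (@le_trans _ _ (\int[P]_w (A%:E + c%:E * (Y w)%:E + (4 * c ^+ 2)%:E * (Y w ^+ 2)%:E))%E).
  apply: ge0_le_integral => //.
  - apply/measurable_EFinP; apply: measurableT_comp => //; apply: measurable_funM => //.
    by apply: measurable_funB => //; exact: measurable_minr.
  - exact: (measurable_int P (integrableD _ iAY icY2)).
  - by move=> w _; rewrite -!EFinM -!EFinD lee_fin pw.
rewrite integralD//= integralD//= !integralZl// integral_cst//.
rewrite [X in (_ * X + _ + _)%E](_ : _ = 1%E); last exact: probability_setT.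
rewrite mule1.
have -> : 1 + 4 * c ^+ 2 * (1 + V + V ^+ 2) = A + c * mu + 4 * c ^+ 2 * (1 + V) by rewrite /A; ring.
rewrite !EFinD [((c * mu)%:E)%E]EFinM [((_ * (1 + V))%:E)%E]EFinM.
by rewrite !leeD// ?lee_wpmul2l.
Qed.

Lemma tail_prob_le (d : measure_display) (T : measurableType d)
    (R : realType) (P : probability T R) (p V M : R) (Y : T -> R) :
  0 < p -> measurable_fun setT Y -> 0 < M ->
  (\int[P]_w (`|Y w| `^ p)%:E <= V%:E)%E ->
  (P [set w | (M < `|Y w|)%R] <= (V * M `^ (- p))%:E)%E.
Proof.
move=> p0 mY M0 YV; set E := [set w | _].
have mnY : measurable_fun setT (fun w => `|Y w|) by exact: measurableT_comp.
have mE : measurable E.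
  rewrite -[X in measurable X]setTI.
  exact: (measurable_fun_ltr (measurable_cst _) mnY measurableT (Y := [set true])).
have mYp : measurable_fun setT (fun w => `|Y w| `^ p).
  by apply: (measurableT_comp (measurable_powR p)).
rewrite powRN EFinM lee_pdivlMr ?powR_gt0//; apply: le_trans YV.
rewrite muleC -integral_cst//.
apply: (@le_trans _ _ (\int[P]_(w in E) (`|Y w| `^ p)%:E)%E).
  apply: ge0_le_integral => //.
  - by move=> w _; rewrite lee_fin powR_ge0.
  - by apply/measurable_EFinP; exact: measurable_funTS.
  - move=> w /= MY; rewrite lee_fin ge0_ler_powR ?nnegrE ?(ltW M0) ?(ltW p0) ?(ltW MY)//.
apply: ge0_subset_integral => //.
exact/measurable_EFinP.
Qed.

(** * Fluctuations over windows *)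

Lemma shifted_powers_summable (R : realType) (gamma : nat -> R) (q C : R) :
  0 <= C -> (\sum_(1 <= n <oo) (gamma n `^ q)%:E < +oo)%E ->
  (\sum_(n <oo) (C * gamma n.+1 `^ q)%:E < +oo)%E.
Proof.
move=> C0 gsum; under eq_eseriesr do rewrite EFinM.
rewrite nneseriesZl//; last by move=> n _; rewrite lee_fin powR_ge0.
rewrite lte_mul_pinfty ?lee_fin//.
rewrite (_ : \sum_(_ <oo) _ = \sum_(1 <= n <oo) (gamma n `^ q)%:E)%E//.
rewrite -(@nneseries_addn R (fun n => (gamma n `^ q)%:E) 1)//.
  by apply: eq_eseriesr => n _; rewrite addn1.
by move=> i; rewrite lee_fin powR_ge0.
Qed.

Lemma powR_eventually_le (R : realType) (gamma : nat -> R) (s e : R) :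
  (forall n, (0 < n)%N -> 0 < gamma n) -> gamma n @[n --> \oo] --> (0 : R) ->
  0 < s -> 0 < e -> exists n0, forall n, (n0 < n)%N -> gamma n `^ s <= e.
Proof.
move=> gpos gcvg s0 e0.
have e1 : 0 < e `^ s^-1 by exact: powR_gt0.
have /cvgrPdist_lt/(_ _ e1)[n0 _ Hn] := gcvg.
exists n0 => n nn; have gn : 0 < gamma n by rewrite gpos// (leq_ltn_trans _ nn).
have : gamma n < e `^ s^-1.
  by have := Hn n (ltnW nn); rewrite sub0r normrN gtr0_norm.
move=> /ltW /(ge0_ler_powR (ltW s0)); rewrite !nnegrE (ltW gn) powR_ge0 => /(_ isT isT).
by rewrite -powRrM mulVf ?gt_eqF// powRr1// ltW.
Qed.

(** The exponent is the one for which Markov's inequality at order [p] produces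
[gamma ^ (1 + p / 3)]. *)
Lemma eventually_small_innovation (dO dS : measure_display)
    (Omega : measurableType dO) (S : measurableType dS) (R : realType)
    (P : probability Omega R) (U : {RV P >-> S}) (Us : nat -> {RV P >-> S})
    (d : nat) (theta : nat -> Omega -> 'rV[R]_d) (gamma : nat -> R) (p V : R)
    (h : S -> 'rV[R]_d -> R) (B : set 'rV[R]_d) :
  iid_copies U Us ->
  (forall n, measurable_fun [set: past (fun k => Us k) n]
      (theta n : past (fun k => Us k) n -> borelRV R d)) ->
  (forall n, (0 < n)%N -> 0 < gamma n) ->
  (\sum_(1 <= n <oo) (gamma n `^ (1 + p / 3))%:E < +oo)%E ->
  measurable_fun [set: S * borelRV R d] (fun z : S * borelRV R d => h z.1 z.2) ->
  measurable (B : set (borelRV R d)) -> 2 <= p ->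
  (forall x, B x -> (\int[P]_w (`|h (U w) x| `^ p)%:E <= V%:E)%E) ->
  {ae P, forall w, exists n0, forall n, (n0 <= n)%N -> B (theta n w) ->
     `|h (Us n.+1 w) (theta n w)| <= gamma n.+1 `^ (- (1 / 3 + 1 / p))}.
Proof.
move=> iid mtheta gpos gsum mh mB p2 hV.
have p0 : 0 < p by apply: lt_le_trans p2.
pose kap := 1 / 3 + 1 / p.
have mU k : measurable_fun [set: Omega] (Us k) by [].
pose E n := [set w | B (theta n w) /\ gamma n.+1 `^ (- kap) < `|h (Us n.+1 w) (theta n w)|].
pose A n := [set z : past (fun k => Us k) n * S |
   B (theta n z.1) /\ gamma n.+1 `^ (- kap) < `|h z.2 (theta n z.1)|].
have mA n : measurable (A n).
  have m1 : measurable_fun setT (fun z : past (fun k => Us k) n * S => theta n z.1 : borelRV R d).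
    exact: measurableT_comp.
  have m2 : measurable_fun setT (fun z : past (fun k => Us k) n * S => `|h z.2 (theta n z.1)|).
    apply: measurableT_comp => //.
    apply: (measurableT_comp mh (g := fun z : past (fun k => Us k) n * S => (z.2, theta n z.1 : borelRV R d))).
    exact: measurable_fun_pair.
  apply: measurableI.
    by rewrite -[X in measurable X]setTI; exact: (m1 measurableT _ mB).
  rewrite -[X in measurable X]setTI.
  exact: (measurable_fun_ltr (measurable_cst _) m2 measurableT (Y := [set true])).
have mE n : measurable (E n).
  have mpair : measurable_fun [set: Omega] (fun w => ((w : past (fun k => Us k) n), Us n.+1 w)).
    by apply: measurable_fun_pair => //; exact: measurable_fun_to_past.
  by rewrite -[X in measurable X]setTI; exact: (mpair measurableT _ (mA n)).
have V0 : forall x, B x -> 0 <= V.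
  move=> x Bx; rewrite -lee_fin; apply: le_trans (hV x Bx).
  by apply: integral_ge0 => w _; rewrite lee_fin powR_ge0.
have PE n : (P (E n) <= (`|V| * gamma n.+1 `^ (1 + p / 3))%:E)%E.
  have -> : P (E n) = (\int[P]_w (\1_(A n) ((w : past (fun k => Us k) n), Us n.+1 w))%:E)%E.
    by rewrite -{1}(setIT (E n)) -integral_indic.
  have C0 : 0 <= `|V| * gamma n.+1 `^ (1 + p / 3) by rewrite mulr_ge0 ?powR_ge0.
  apply: (le_trans (expectation_freezing_le (b := cst (`|V| * gamma n.+1 `^ (1 + p / 3))%:E) iid
     (g := fun z => (\1_(A n) z)%:E) _ _ _ _)) => //.
  - by apply/measurable_EFinP; exact: measurable_indic.
  - move=> w /=.
    have [Bw|nBw] := pselect (B (theta n w)); last first.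
      rewrite integral0_eq ?lee_fin// => w' _; rewrite indicE.
      by case: (boolP (_ \in _)) => // /set_mem[].
    have mY : measurable_fun [set: Omega] (fun w' => h (U w') (theta n w)).
      apply: (measurableT_comp mh (g := fun w' : Omega => (U w', theta n w : borelRV R d))).
      exact: measurable_fun_pair.
    have g0 : 0 < gamma n.+1 `^ (- kap) by rewrite powR_gt0// gpos.
    have := tail_prob_le p0 mY g0 (hV _ Bw).
    rewrite -powRrM mulrNN.
    have -> : kap * p = 1 + p / 3 by rewrite /kap; field; exact: lt0r_neq0.
    rewrite (ger0_norm (V0 _ Bw)); apply: le_trans.
    rewrite le_eqVlt; apply/orP; left; apply/eqP.
    rewrite -[in RHS](setIT [set _ | _]) -integral_indic//.
      apply: eq_integral => w' _; congr (_%:E); rewrite !indicE; congr (_%:R).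
      by congr nat_of_bool; apply/idP/idP => /set_mem; [case=> _ ?|move=> ?]; apply/mem_set.
    rewrite -[X in measurable X]setTI.
    apply: (measurable_fun_ltr (measurable_cst _) _ measurableT (Y := [set true])) => //.
    exact: measurableT_comp.
  - rewrite integral_cst// -[leRHS]mule1 lee_wpmul2l ?lee_fin//.
    exact: probability_le1.
have csum := shifted_powers_summable (normr_ge0 V) gsum.
have := borel_cantelli_ae mE _ PE csum.
have c0 n : 0 <= `|V| * gamma n.+1 `^ (1 + p / 3) by rewrite mulr_ge0 ?powR_ge0.
move=> /(_ c0); apply: filterS => w [n0 H]; exists n0 => n nn Bn.
by rewrite leNgt; apply/negP => lt; apply: (H n nn); split.
Qed.

(** The function [mu] is any upper bound of the conditional mean.  Windows are
indexed so that the step from [theta k] uses [Us k.+1] and [gamma k.+1].  For a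
window that starts at [n], the exponential supermartingale with parameter [lam n] of order
[gamma n.+1 ^ (- s)], where [s = 1 - kap], is used: it is the largest order for which
the truncated increments stay bounded after scaling. *)
Lemma noise_drift_le (dO dS : measure_display)
    (Omega : measurableType dO) (S : measurableType dS) (R : realType)
    (P : probability Omega R) (U : {RV P >-> S}) (Us : nat -> {RV P >-> S})
    (d : nat) (theta : nat -> Omega -> 'rV[R]_d) (gamma : nat -> R) (p V del : R)
    (h : S -> 'rV[R]_d -> R) (mu : 'rV[R]_d -> R) (B : set 'rV[R]_d) :
  iid_copies U Us ->
  (forall n, measurable_fun [set: past (fun k => Us k) n]
      (theta n : past (fun k => Us k) n -> borelRV R d)) ->
  (forall n, (0 < n)%N -> 0 < gamma n) ->
  (forall m n, (0 < m)%N -> (m <= n)%N -> gamma n <= gamma m) ->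
  gamma n @[n --> \oo] --> (0 : R) ->
  (\sum_(1 <= n <oo) (gamma n `^ (1 + p / 3))%:E < +oo)%E ->
  measurable_fun [set: S * borelRV R d] (fun z : S * borelRV R d => h z.1 z.2) ->
  measurable_fun [set: borelRV R d] (mu : borelRV R d -> R) ->
  measurable (B : set (borelRV R d)) -> 2 <= p -> 0 <= V -> 0 < del ->
  (forall x, B x -> [/\ (\int[P]_w (`|h (U w) x| `^ p)%:E <= V%:E)%E,
     (\int[P]_w (h (U w) x)%:E <= (mu x)%:E)%E & `|mu x| <= V]) ->
  {ae P, forall w, exists n0, forall n N, (n0 <= n)%N -> (n <= N)%N ->
     (forall k, (n <= k)%N -> (k < N)%N -> B (theta k w)) ->
     \sum_(n <= k < N) gamma k.+1 * (h (Us k.+1 w) (theta k w) - mu (theta k w))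
       <= del * (1 + \sum_(n <= k < N) gamma k.+1)}.
Proof.
move=> iid mtheta gpos gdecr gcvg gsum mh mmu mB p2 V0 del0 hB.
have p0 : 0 < p by apply: lt_le_trans p2.
pose kap := 1 / 3 + 1 / p; pose s := 1 - kap.
have pV : 1 / p <= 1 / 2 by rewrite !div1r lef_pV2 ?posrE.
have pV0 : 0 < 1 / p by rewrite divr_gt0.
have kap0 : 0 < kap by rewrite /kap; lra.
have s0 : 0 < s by rewrite /s /kap; lra.
have s1 : s <= 1 by rewrite /s; lra.
pose W := 1 + V + V ^+ 2.
have W0 : 0 < W by rewrite /W; have := sqr_ge0 V; lra.
pose c0 : R := (2 * (1 + V))^-1.
have c00 : 0 < c0 by rewrite invr_gt0; lra.
pose lam n := c0 * gamma n.+1 `^ (- s).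
have lam0 n : 0 < lam n by rewrite mulr_gt0// powR_gt0// gpos.
pose M n := gamma n.+1 `^ (- kap).
have M0 n : 0 <= M n by exact: powR_ge0.
(* the indicator of [B] makes the bounds hold at every point, and [del] is
   the drift that pays for the second order term of the exponential *)
pose psi n k (u : S) (x : 'rV[R]_d) : R :=
  lam n * gamma k.+1 * (\1_B x * (Num.min (h u x) (M k) - mu x) - del).
(* once the step sizes are small, each factor has expectation at most one *)
have [n1 Hn1] : exists n1, forall n, (n1 <= n)%N ->
    gamma n.+1 <= 1 /\ 4 * W * c0 * gamma n.+1 `^ kap <= del.
  have q0 : 0 < 4 * W * c0 by rewrite !mulr_gt0.
  have [n1 H1] := powR_eventually_le gpos gcvg ltr01 ltr01.
  have [n2 H2] := powR_eventually_le gpos gcvg kap0 (divr_gt0 del0 q0).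
  exists (maxn n1 n2) => n; rewrite geq_max => /andP[n1n n2n]; split.
    by have := H1 n.+1 n1n; rewrite powRr1// ltW// gpos.
  by have := H2 n.+1 n2n; rewrite ler_pdivlMr// mulrC.
have gs (g : R) : 0 < g -> g <= 1 -> g * (g `^ (- kap) + V) <= (1 + V) * g `^ s.
  move=> g0 g1.
  have gS : g * g `^ (- kap) = g `^ s.
    by rewrite -{1}[g](powRr1 (ltW g0)) -powRD// gt_eqF ?implybT.
  have : g <= g `^ s.
    by apply: ger1_powR => //; rewrite g0.
  rewrite mulrDr gS; have := powR_ge0 g s; nra.
have psi1 n k x : (n1 <= n)%N -> (n <= k)%N ->
    (\int[P]_w (expR (psi n k (U w) x))%:E <= 1)%E.
  move=> nn nk; have [g1 gd] := Hn1 n nn.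
  have gn : 0 < gamma n.+1 by rewrite gpos.
  have gk : 0 < gamma k.+1 by rewrite gpos.
  have gkn : gamma k.+1 <= gamma n.+1 by rewrite gdecr.
  have lg0 : 0 < lam n * gamma k.+1 by rewrite mulr_gt0.
  have [Bx|nBx] := pselect (B x); last first.
    rewrite (eq_integral (cst (expR (lam n * gamma k.+1 * - del))%:E)); last first.
      move=> w _; rewrite /psi indicE (_ : (x \in B) = false) ?mul0r ?sub0r//.
      by apply/negbTE; rewrite notin_setE.
    rewrite integral_cst// -[leRHS]mule1 lee_pmul ?lee_fin ?expR_ge0//.
      by rewrite -expR0 ler_expR mulrN oppr_le0 mulr_ge0// ltW.
    exact: probability_le1.
  have [hV hmu muV] := hB x Bx.
  have mY : measurable_fun [set: Omega] (fun w => h (U w) x).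
    apply: (measurableT_comp mh (g := fun w : Omega => (U w, x : borelRV R d))).
    exact: measurable_fun_pair.
  rewrite (eq_integral (fun w => (expR (- (lam n * gamma k.+1 * del)))%:E *
      (expR (lam n * gamma k.+1 * (Num.min (h (U w) x) (M k) - mu x)))%:E)%E); last first.
    move=> w _; rewrite -EFinM -expRD /psi indicE mem_set// mul1r; congr (expR _)%:E; ring.
  rewrite ge0_integralZl//=; last first.
    apply/measurable_EFinP; apply: measurableT_comp => //; apply: measurable_funM => //.
    by apply: measurable_funB => //; exact: measurable_minr.
  (* the increment after scaling is at most one half, as the exponential bound
     requires *)
  have step : lam n * gamma k.+1 * (M k + V) <= 1 / 2.
    rewrite -mulrA; apply: (le_trans (ler_wpM2l (ltW (lam0 n)) (gs _ gk (le_trans gkn g1)))).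
    have : gamma k.+1 `^ s <= gamma n.+1 `^ s.
      by apply: ge0_ler_powR; rewrite ?nnegrE // ltW.
    have V1 : 0 < 1 + V by lra.
    move=> /(ler_wpM2l (ltW V1))/(ler_wpM2l (ltW (lam0 n)))/le_trans; apply.
    rewrite /lam powRN /c0 le_eqVlt; apply/orP; left; apply/eqP; field.
    by rewrite !lt0r_neq0// powR_gt0.
  have := truncated_mgf_le p2 mY hV hmu muV (M0 k) (ltW lg0) step.
  move=> /(lee_wpmul2l _)/le_trans; apply; first by rewrite lee_fin expR_ge0.
  rewrite -EFinM lee_fin.
  apply: (@le_trans _ _ (expR (- (lam n * gamma k.+1 * del)) *
     expR (4 * (lam n * gamma k.+1) ^+ 2 * W))).
    by rewrite ler_wpM2l ?expR_ge0// expR_ge1Dx.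
  rewrite -expRD -[leRHS]expR0 ler_expR.
  have : 4 * W * (lam n * gamma k.+1) <= del.
    apply: le_trans gd; rewrite -!mulrA !ler_wpM2l ?(ltW W0) ?(ltW c00)//.
    have -> : kap = - s + 1 by rewrite /s; ring.
    rewrite powRD ?powRr1 ?(ltW gn)//; last by rewrite (gt_eqF gn) implybT.
    by rewrite ler_wpM2l ?powR_ge0.
  nra.
(* the power of [lam n * del] that turns [gamma ^ (- s)] into the summable one *)
pose N := (1 + p / 3) / s.
have N0 : 0 < N by rewrite divr_gt0// addr_gt0// divr_gt0.
pose C := N `^ N * (c0 * del) `^ (- N).
have C0 : 0 <= C by rewrite mulr_ge0 ?powR_ge0.
have expC n : expR (- (lam n * del)) <= C * gamma n.+1 `^ (1 + p / 3).
  have gn : 0 < gamma n.+1 by rewrite gpos.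
  apply: (le_trans (expRN_le_powR N0 _)); first by rewrite mulr_gt0.
  rewrite /C -mulrA ler_wpM2l ?powR_ge0//.
  rewrite /lam mulrAC [leLHS]powRM ?powR_ge0 ?mulr_ge0 ?(ltW c00) ?(ltW del0)//.
  rewrite -powRrM (_ : - s * - N = 1 + p / 3)//.
  by rewrite mulrNN /N mulrC divfK ?gt_eqF.
have bad n : exists E : set Omega, [/\ measurable E,
    (P E <= (C * gamma n.+1 `^ (1 + p / 3))%:E)%E &
    (n1 <= n)%N -> forall w N, (n <= N)%N ->
      lam n * del <= \sum_(n <= k < N) psi n k (Us k.+1 w) (theta k w) -> E w].
  have [nn|nn] := leqP n1 n; last first.
    exists set0; split => //; rewrite measure0 lee_fin mulr_ge0 ?powR_ge0//.
  have mpsi k : measurable_fun [set: S * borelRV R d]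
      (fun z : S * borelRV R d => psi n k z.1 z.2).
    apply: measurable_funM => //; apply: measurable_funB => //; apply: measurable_funM.
      have mI : measurable_fun [set: borelRV R d] (\1_B : borelRV R d -> R).
        exact: measurable_indic.
      exact: (measurableT_comp mI measurable_snd).
    apply: measurable_funB; first exact: measurable_minr.
    exact: (measurableT_comp mmu measurable_snd).
  have [E [mE PE HE]] := maximal_inequality (n := n) (lam n * del) iid mtheta mpsi
     (fun k x nk => psi1 n k x nn nk).
  exists E; split=> //.
  by apply: (le_trans PE); rewrite lee_fin.
have [E HE] := choice bad.
have mE n : measurable (E n) by have [] := HE n.
have PE n : (P (E n) <= (C * gamma n.+1 `^ (1 + p / 3))%:E)%E by have [] := HE n.
have cn n : 0 <= C * gamma n.+1 `^ (1 + p / 3) by rewrite mulr_ge0 ?powR_ge0.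
have csum := shifted_powers_summable C0 gsum.
have ae1 := borel_cantelli_ae mE cn PE csum.
have ae2 := eventually_small_innovation iid mtheta gpos gsum mh mB p2
  (fun x Bx => let: And3 a _ _ := hB x Bx in a).
apply: filterS2 ae1 ae2 => w [n2 H2] [n3 H3].
exists (maxn n1 (maxn n2 n3)) => n N'.
rewrite !geq_max => /and3P[n1n n2n n3n] nN HB.
rewrite leNgt; apply/negP => lt; apply: (H2 n n2n).
have [_ _ /(_ n1n) H] := HE n; apply: (H w N' nN).
have -> : \sum_(n <= k < N') psi n k (Us k.+1 w) (theta k w)
   = lam n * (\sum_(n <= k < N') gamma k.+1 * (h (Us k.+1 w) (theta k w) - mu (theta k w))
        - del * \sum_(n <= k < N') gamma k.+1).
  rewrite mulrBr !mulr_sumr -sumrB; apply: eq_big_nat => k /andP[nk kN].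
  have Bk := HB k nk kN.
  rewrite /psi indicE mem_set// mul1r min_l; first by ring.
  by apply: le_trans (H3 k (leq_trans n3n nk) Bk); exact: ler_norm.
rewrite ler_pM2l//; move: lt; rewrite mulrDr mulr1; lra.
Qed.

(** * Analysis on row vectors *)

Lemma rV_coord_le (R : realType) (d : nat) (x : 'rV[R]_d) (i : 'I_d) :
  `|x ord0 i| <= `|x|.
Proof.
rewrite [leRHS]/Num.Def.normr/= mx_normrE.
exact: (le_bigmax 0 (fun ij : 'I_1 * 'I_d => `|x ij.1 ij.2|) (ord0, i)).
Qed.

Lemma rV_coord_sub_le (R : realType) (d : nat) (x y : 'rV[R]_d) (i : 'I_d) :
  `|x ord0 i - y ord0 i| <= `|x - y|.
Proof. by have := rV_coord_le (x - y) i; rewrite !mxE. Qed.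

Lemma rV_norm_le (R : realType) (d : nat) (x : 'rV[R]_d) (c : R) :
  0 <= c -> (forall i, `|x ord0 i| <= c) -> `|x| <= c.
Proof.
move=> c0 xc; rewrite [leLHS]/Num.Def.normr/= mx_normrE.
by apply: bigmax_le => // -[i j] _; rewrite ord1.
Qed.

Lemma sqr_norm_le_sum (R : realType) (d : nat) (x : 'rV[R]_d) :
  `|x| ^+ 2 <= \sum_i x ord0 i ^+ 2.
Proof.
have S0 : 0 <= \sum_i x ord0 i ^+ 2 by apply: sumr_ge0 => i _; exact: sqr_ge0.
rewrite -[leRHS]sqr_sqrtr// ler_pXn2r// ?nnegrE ?sqrtr_ge0//.
apply: rV_norm_le; first exact: sqrtr_ge0.
move=> i; rewrite -sqrtr_sqr ler_wsqrtr// (bigD1 i)//= lerDl.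
by apply: sumr_ge0 => j _; exact: sqr_ge0.
Qed.

Lemma enorm_le_norm (R : realType) (d : nat) (x : 'rV[R]_d) :
  enorm x <= d%:R * `|x|.
Proof.
case: d x => [x|d x]; first by rewrite /enorm big_ord0 sqrtr0 mul0r.
rewrite -[leRHS]ger0_norm ?mulr_ge0// -sqrtr_sqr ler_wsqrtr//.
apply: (@le_trans _ _ (\sum_(i < d.+1) `|x| ^+ 2)).
  apply: ler_sum => i _; rewrite -(real_normK (num_real (x _ _))).
  by rewrite ler_pXn2r ?nnegrE// rV_coord_le.
rewrite sumr_const card_ord -[leLHS]mulr_natl exprMn ler_wpM2r ?sqr_ge0//.
by rewrite -natrX ler_nat expnS expn1 leq_pmulr.
Qed.

Lemma norm_le_enorm (R : realType) (d : nat) (x : 'rV[R]_d) : `|x| <= enorm x.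
Proof.
rewrite -[leLHS]ger0_norm// -sqrtr_sqr ler_wsqrtr//.
exact: sqr_norm_le_sum.
Qed.

(** Lebesgue's number lemma for a binary property that holds locally near the
diagonal. *)
Lemma compact_uniform_radius (R : realType) (d : nat) (K : set 'rV[R]_d)
    (Q : 'rV[R]_d -> 'rV[R]_d -> Prop) :
  compact K ->
  (forall x, K x -> exists2 s, 0 < s &
     forall z y, `|x - z| < s -> `|x - y| < s -> Q z y) ->
  exists2 r, 0 < r & forall x y, K x -> `|y - x| < r -> Q x y.
Proof.
move=> /compact_near_coveringP cK loc.
pose T (r : R) x := forall y, `|y - x| < r -> Q x y.
have KT : \forall r \near 0^'+, K `<=` T r.
  apply: cK => x /loc[s s0 sP].
  have s20 : 0 < s / 2 by rewrite divr_gt0.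
  have nz : \forall z \near x, `|x - z| < s / 2.
    by apply/nbhs_ballP; exists (s / 2) => //= z; rewrite -ball_normE.
  near=> z r => y yz.
  have zx : `|x - z| < s / 2 by near: z.
  have rs : r < s / 2 by near: r; exact: nbhs_right_lt.
  apply: sP; first by rewrite (lt_trans zx)// ltr_pdivrMr// ltr_pMr// ltr1n.
  rewrite -(subrKA z) [s in _ < s]splitr.
  by rewrite (le_lt_trans (ler_normD _ _))// ltrD// distrC (lt_trans yz).
near (0 : R)^'+ => r; exists r; first by near: r; exact: nbhs_right_gt.
suff KTr : K `<=` T r by move=> x y Kx; exact: KTr.
by near: r.
Unshelve. all: by end_near. Qed.

Lemma compact_unif_continuous (R : realType) (d : nat) (V : normedModType R)
    (g : 'rV[R]_d -> V) (K : set 'rV[R]_d) (e : R) :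
  continuous g -> compact K -> 0 < e ->
  exists2 r, 0 < r & forall x y, K x -> `|y - x| < r -> `|g y - g x| < e.
Proof.
move=> cg cK e0; apply: compact_uniform_radius => // x Kx.
have e20 : 0 < e / 2 by rewrite divr_gt0.
have /cvgrPdist_lt/(_ _ e20)/nbhs_ballP[s /= s0 sP] := cg x.
exists s => // z y xz xy.
have A : `|g x - g y| < e / 2 by apply: sP; rewrite -ball_normE.
have B : `|g x - g z| < e / 2 by apply: sP; rewrite -ball_normE.
rewrite -(subrKA (g x)) [e in _ < e]splitr.
by rewrite (le_lt_trans (ler_normD _ _))// ltrD// distrC.
Qed.

Lemma compact_thickening (R : realType) (d : nat) (A W : set 'rV[R]_d) :
  compact A -> open W -> A `<=` W ->
  exists2 r, 0 < r & forall x y, A x -> `|y - x| < r -> W y.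
Proof.
move=> cA oW AW; apply: compact_uniform_radius => // x Ax.
have /nbhs_ballP[s /= s0 sP] : nbhs x W by apply: open_nbhs_nbhs; split=> //; exact: AW.
by exists s => // z y _ xy; apply: sP; rewrite -ball_normE.
Qed.

Lemma compact_gap (R : realType) (d : nat) (f : 'rV[R]_d -> R)
    (Q : set 'rV[R]_d) (c : R) :
  continuous f -> compact Q -> (forall x, Q x -> c < f x) ->
  exists2 e, 0 < e & forall x, Q x -> c + e <= f x.
Proof.
move=> cf cQ Qc; have [->|/set0P Q0] := eqVneq Q set0; first by exists 1.
have [x /set_mem Qx xmin] := EVT_min_rV Q0 cQ (continuous_subspaceT cf).
exists (f x - c); first by rewrite subr_gt0 Qc.
by move=> y Qy; rewrite addrCA subrr addr0 xmin// inE.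
Qed.

Lemma derive_grad (R : realType) (d : nat) (f : 'rV[R]_d -> R) (x v : 'rV[R]_d) :
  differentiable f x -> 'D_v f x = \sum_j grad f x ord0 j * v ord0 j.
Proof.
move=> df; rewrite deriveE// {1}[v]row_sum_delta linear_sum.
apply: eq_bigr => j _.
by rewrite linearZ /= mxE deriveE// mulrC.
Qed.

Lemma mean_value_grad (R : realType) (d : nat) (f : 'rV[R]_d -> R) (x v : 'rV[R]_d) :
  (forall x, differentiable f x) ->
  exists2 t, 0 <= t <= 1 &
    f (x + v) - f x = \sum_j grad f (x + t *: v) ord0 j * v ord0 j.
Proof.
(* the restriction of [f] to the segment from [x] to [x + v] *)
move=> df; pose phi (t : R) := f (x + t *: v).
have quot (t h : R) : phi (h *: (1 : R) + t) - phi t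
   = f (h *: v + (x + t *: v)) - f (x + t *: v).
  by rewrite /phi scalerDl [_ *: 1]mulr1 addrCA.
have dphi t : is_derive t (1 : R) phi ('D_v f (x + t *: v)).
  have dv : derivable f (x + t *: v) v by exact: diff_derivable.
  split.
    rewrite /derivable; under eq_fun do rewrite quot.
    exact: dv.
  by rewrite /derive; under eq_fun do rewrite quot.
have [t t01 E] : exists2 t, t \in `]0, 1[%R & phi 1 - phi 0 = 'D_v f (x + t *: v) * (1 - 0).
  apply: MVT => //.
  apply: continuous_subspaceT => t.
  by apply: differentiable_continuous; apply/derivable1_diffP; have [] := dphi t.
exists t; first by move: t01; rewrite in_itv/= => /andP[/ltW -> /ltW ->].
rewrite -derive_grad//; move: E.
by rewrite /phi scale1r scale0r addr0 subr0 mulr1.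
Qed.

Lemma increment_sum_le (R : realType) (d : nat) (theta : nat -> 'rV[R]_d)
    (gamma : nat -> R) (B : R) (n N : nat) :
  (forall k, `|theta k.+1 - theta k| <= B * gamma k.+1) -> (n <= N)%N ->
  `|theta N - theta n| <= B * \sum_(n <= k < N) gamma k.+1.
Proof.
move=> step nN; rewrite -telescope_sumr// mulr_sumr.
by apply: (le_trans (ler_norm_sum _ _ _)); apply: ler_sum.
Qed.

(** The mean value theorem freezes the gradient at the start of the window, at the cost
of its oscillation [w] there; the relative drift error takes half of the main
term [t / eps * u ^+ 2]. *)
Lemma window_descent (R : realType) (d : nat) (f : 'rV[R]_d -> R)
    (theta : nat -> 'rV[R]_d) (gamma : nat -> R) (B eps w del : R) (n N : nat) :
  let t := \sum_(n <= k < N) gamma k.+1 in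
  let g := grad f in
  let u := `|g (theta n)| in
  (0 < d)%N -> 0 < eps -> 0 <= B ->
  (forall x, differentiable f x) -> (forall k, 0 < gamma k.+1) ->
  (forall k, `|theta k.+1 - theta k| <= B * gamma k.+1) -> (n <= N)%N ->
  (forall j, `|theta N ord0 j - theta n ord0 j
               + eps^-1 * \sum_(n <= k < N) gamma k.+1 * g (theta k) ord0 j|
     <= (2 * eps * d%:R)^-1 * \sum_(n <= k < N) gamma k.+1 * `|g (theta k)|
        + del * (1 + t)) ->
  (forall z, `|z - theta n| <= B * t -> `|g z - g (theta n)| <= w) ->
  f (theta N) - f (theta n)
    <= - (t / (2 * eps)) * u ^+ 2
       + t * w * (u * (d%:R + 1) / eps + d%:R * B) + d%:R * u * (del * (1 + t)).
Proof.
move=> t g u d0 e0 B0 df gpos step nN drift osc.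
have dR : 0 < d%:R :> R by rewrite ltr0n.
have u0 : 0 <= u by exact: normr_ge0.
have t0 : 0 <= t by apply: sumr_ge0 => k _; exact: ltW.
have w0 : 0 <= w.
  by apply: le_trans (osc (theta n) _) => //; rewrite subrr normr0 mulr_ge0.
pose v := theta N - theta n.
have vB : `|v| <= B * t by exact: increment_sum_le.
have [s s01 fE] := mean_value_grad (theta n) v df.
have -> : f (theta N) - f (theta n) = f (theta n + v) - f (theta n).
  by rewrite /v (addrC (theta n)) subrK.
rewrite fE.
have zosc : `|g (theta n + s *: v) - g (theta n)| <= w.
  apply: osc; rewrite addrAC subrr add0r normrZ; apply: le_trans vB.
  by case/andP: s01 => s0 s1; rewrite ger0_norm// ler_piMl.
have kosc k : (n <= k)%N -> (k < N)%N -> `|g (theta k) - g (theta n)| <= w.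
  move=> nk kN; apply: osc; apply: (le_trans (increment_sum_le step nk)).
  rewrite ler_wpM2l// /t (big_cat_nat nk (ltnW kN))//= lerDl.
  by apply: sumr_ge0 => i _; exact: ltW.
pose a := (2 * eps * d%:R)^-1.
have a0 : 0 <= a by rewrite invr_ge0 !mulr_ge0// ltW.
have gsum : \sum_(n <= k < N) gamma k.+1 * `|g (theta k)| <= t * (u + w).
  rewrite mulr_suml; apply: ler_sum_nat => k /andP[nk kN].
  rewrite ler_wpM2l ?(ltW (gpos k))//.
  rewrite -(subrK (g (theta n)) (g (theta k))) (le_trans (ler_normD _ _))// addrC lerD//.
  exact: kosc.
have coord j : g (theta n + s *: v) ord0 j * v ord0 j
   <= - (t / eps) * g (theta n) ord0 j ^+ 2
      + (t / eps * (u * w) + u * (a * (t * (u + w)) + del * (1 + t)) + w * (B * t)).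
  set gj := g (theta n) ord0 j.
  have gju : `|gj| <= u by exact: rV_coord_le.
  have vj : `|v ord0 j| <= B * t by exact: le_trans (rV_coord_le _ _) vB.
  have diffj : `|g (theta n + s *: v) ord0 j - gj| <= w.
    exact: le_trans (rV_coord_sub_le _ _ _) zosc.
  set E := theta N ord0 j - theta n ord0 j + eps^-1 * \sum_(n <= k < N) gamma k.+1 * g (theta k) ord0 j.
  have EE : `|E| <= a * (t * (u + w)) + del * (1 + t).
    by apply: (le_trans (drift j)); rewrite lerD2r ler_wpM2l.
  have vE : v ord0 j = - (eps^-1 * \sum_(n <= k < N) gamma k.+1 * g (theta k) ord0 j) + E.
    by rewrite /E /v !mxE; ring.
  (* the gradient along the window stays within [w] of its initial value *)
  have lower : t * (gj ^+ 2 - u * w) <= gj * \sum_(n <= k < N) gamma k.+1 * g (theta k) ord0 j.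
    rewrite mulr_suml mulr_sumr; apply: ler_sum_nat => k /andP[nk kN].
    rewrite mulrCA ler_wpM2l ?(ltW (gpos k))//.
    have : `|g (theta k) ord0 j - gj| <= w.
      exact: le_trans (rV_coord_sub_le _ _ _) (kosc k nk kN).
    set y := g (theta k) ord0 j => yw.
    have : `|gj * (y - gj)| <= u * w by rewrite normrM ler_pM.
    rewrite ler_norml => /andP[+ _].
    have -> : gj * y = gj ^+ 2 + gj * (y - gj) by ring.
    lra.
  have -> : g (theta n + s *: v) ord0 j * v ord0 j
     = gj * v ord0 j + (g (theta n + s *: v) ord0 j - gj) * v ord0 j by ring.
  have P1 : (g (theta n + s *: v) ord0 j - gj) * v ord0 j <= w * (B * t).
    by apply: (le_trans (ler_norm _)); rewrite normrM ler_pM.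
  have P2 : gj * E <= u * (a * (t * (u + w)) + del * (1 + t)).
    by apply: (le_trans (ler_norm _)); rewrite normrM ler_pM.
  have eV : 0 <= eps^-1 by rewrite invr_ge0 ltW.
  have := ler_wpM2l eV lower.
  have -> : gj * v ord0 j = gj * (- (eps^-1 * \sum_(n <= k < N) gamma k.+1 * g (theta k) ord0 j) + E) by rewrite {1}vE.
  set Sg := \sum_(_ <= _ < _) _.
  have -> : gj * (- (eps^-1 * Sg) + E) = - (eps^-1 * (gj * Sg)) + gj * E by ring.
  have -> : eps^-1 * (t * (gj ^+ 2 - u * w)) = t / eps * gj ^+ 2 - t / eps * (u * w) by ring.
  lra.
apply: (le_trans (ler_sum _ (fun j _ => coord j))).
rewrite big_split/= -mulr_sumr sumr_const card_ord -[X in _ + X <= _]mulr_natl.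
have S : u ^+ 2 <= \sum_j g (theta n) ord0 j ^+ 2 by exact: sqr_norm_le_sum.
have te : 0 <= t / eps by rewrite divr_ge0// ltW.
have := ler_wpM2l te S.
have -> : d%:R * (t / eps * (u * w) + u * (a * (t * (u + w)) + del * (1 + t)) + w * (B * t))
  = t / (2 * eps) * u ^+ 2 + t * w * (u * (d%:R + 2^-1) / eps + d%:R * B) + d%:R * u * (del * (1 + t)).
  by rewrite /a; field; rewrite !lt0r_neq0.
have -> : t / eps * u ^+ 2 = t / (2 * eps) * u ^+ 2 + t / (2 * eps) * u ^+ 2.
  by field; rewrite lt0r_neq0.
have : t * w * (u * (d%:R + 2^-1) / eps + d%:R * B) <= t * w * (u * (d%:R + 1) / eps + d%:R * B).
  rewrite ler_wpM2l ?mulr_ge0// lerD2r ler_wpM2r ?invr_ge0 ?(ltW e0)// ler_wpM2l// lerD2l.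
  by rewrite invf_le1// ler1n.
rewrite !mulNr; lra.
Qed.

(** * Descent of approximate gradient iterations *)

Lemma nonsummable_tail (R : realType) (gamma : nat -> R) :
  (forall n, (0 < n)%N -> 0 < gamma n) ->
  (\sum_(1 <= n <oo) (gamma n)%:E = +oo)%E ->
  forall n (T : R), exists N, (n <= N)%N /\ T <= \sum_(n <= k < N) gamma k.+1.
Proof.
move=> gpos gsum n T; apply: contrapT => nex.
have bnd N : \sum_(0 <= k < N) gamma k.+1 <= \sum_(0 <= k < n) gamma k.+1 + `|T|.
  have [Nn|nN] := leqP N n.
    rewrite (big_cat_nat _ Nn)//= -addrA lerDl addr_ge0//.
    by apply: sumr_ge0 => k _; rewrite ltW// gpos.
  rewrite (big_cat_nat _ (ltnW nN))//= lerD2l.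
  apply: (@le_trans _ _ T); last exact: ler_norm.
  by rewrite leNgt; apply/negP => /ltW TN; apply: nex; exists N; split; [exact: ltnW|].
have : (\sum_(1 <= k <oo) (gamma k)%:E <= (\sum_(0 <= k < n) gamma k.+1 + `|T|)%:E)%E.
  apply: lime_le.
    by apply: is_cvg_nneseries => k k1 _; rewrite lee_fin ltW// gpos.
  apply: nearW => N; case: N => [|N].
    by rewrite big_geq// lee_fin (le_trans _ (bnd 0%N))// big_geq.
  by rewrite sumEFin lee_fin big_add1.
by rewrite gsum leye_eq.
Qed.

Lemma window_exists (R : realType) (gamma : nat -> R) :
  (forall n, (0 < n)%N -> 0 < gamma n) ->
  (\sum_(1 <= n <oo) (gamma n)%:E = +oo)%E ->
  forall (T : R) n, 0 < T -> (forall k, (n <= k)%N -> gamma k.+1 <= T) ->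
  exists N, [/\ (n < N)%N, T <= \sum_(n <= k < N) gamma k.+1 &
      \sum_(n <= k < N) gamma k.+1 <= 2 * T].
Proof.
move=> gpos gsum T n T0 gT.
pose Q N := (n <= N)%N && (T <= \sum_(n <= k < N) gamma k.+1).
have exQ : exists N, Q N.
  by have [N [nN TN]] := nonsummable_tail gpos gsum n T; exists N; rewrite /Q nN.
case: (ex_minnP exQ) => N /andP[nN TN] Nmin.
have nltN : (n < N)%N.
  rewrite ltn_neqAle nN andbT; apply/eqP => nE.
  by move: TN; rewrite nE big_geq// leNgt T0.
exists N; split => //.
case: N nltN nN TN Nmin => // N nltN nN TN Nmin.
have nN' : (n <= N)%N by rewrite -ltnS.
rewrite big_nat_recr//= mulr2n mulrDl mul1r lerD ?gT//.
rewrite leNgt; apply/negP => /ltW TN'.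
by have := Nmin N; rewrite /Q nN' TN' ltnn => /(_ isT).
Qed.

Lemma edist_set_le (R : realType) (d : nat) (x a : 'rV[R]_d) (C : set 'rV[R]_d) :
  C a -> 0 <= edist_set x C <= enorm (x - a).
Proof.
move=> Ca.
have lb : lbound [set enorm (x - y) | y in C] 0.
  by move=> _ [y _ <-]; exact: sqrtr_ge0.
apply/andP; split; first by apply: lb_le_inf => //; exists (enorm (x - a)); exists a.
by apply: ge_inf; [exists 0|exists a].
Qed.

Lemma iterated_windows (a : nat -> nat) (I k : nat) :
  (forall i, (a i < a i.+1)%N) -> (a I <= k)%N ->
  exists2 i, (I <= i)%N & (a i <= k <= a i.+1)%N.
Proof.
move=> amono; elim: k => [|k IH] ak.
  by exists I => //; rewrite ak (leq_trans _ (ltnW (amono I))).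
move: ak; rewrite leq_eqVlt => /predU1P[<-|].
  by exists I => //; rewrite leqnn ltnW.
rewrite ltnS => /IH[i Ii /andP[ik ki]].
move: ki; rewrite leq_eqVlt => /predU1P[->|ki].
  by exists i.+1; rewrite ?leqnSn//= ?(leq_trans Ii)// leqnSn/= amono.
by exists i => //; rewrite (leq_trans ik).
Qed.

(** On [K] and [closure D], away from [C], the values of [f] are bounded away from the
minimum.  Let [W0] be the part of [D] where the gradient is below [u0].  Inside [K], a
sublevel set of [f] in [W0] lies deep inside it, and short windows that start in the
sublevel set cannot leave [W0]; the drift hypothesis is then
available on the whole window and, by [window_descent], leads back into the sublevel
set.  The neighbourhood [V] is chosen before the trajectory and the step sizes, so
one choice serves almost all sample paths. *)
Lemma confined_descent_cvg (R : realType) (d : nat) (f : 'rV[R]_d -> R)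
    (C K D : set 'rV[R]_d) (B eps u0 : R) :
  (0 < d)%N -> 0 < eps -> 0 < B -> 0 < u0 -> is_C1 f ->
  closed C -> compact K -> open D -> C `&` K `<=` D ->
  (forall x, C x -> grad f x = 0) ->
  C `&` closure D = argmin_on f (closure D) ->
  argmin_on f (closure D) = [set x | closure D x /\ grad f x = 0] ->
  exists V : set 'rV[R]_d, set_nbhs (C `&` K) V /\
  forall (theta : nat -> 'rV[R]_d) (gamma : nat -> R),
    (forall n, (0 < n)%N -> 0 < gamma n) ->
    gamma n @[n --> \oo] --> (0 : R) ->
    (\sum_(1 <= n <oo) (gamma n)%:E = +oo)%E ->
    (forall k, `|theta k.+1 - theta k| <= B * gamma k.+1) ->
    (forall del, 0 < del -> exists n0, forall n N, (n0 <= n)%N -> (n <= N)%N ->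
       (forall k, (n <= k)%N -> (k < N)%N ->
          [/\ K (theta k), D (theta k) & `|grad f (theta k)| < u0]) ->
       forall j, `|theta N ord0 j - theta n ord0 j
               + eps^-1 * \sum_(n <= k < N) gamma k.+1 * grad f (theta k) ord0 j|
         <= (2 * eps * d%:R)^-1 * \sum_(n <= k < N) gamma k.+1 * `|grad f (theta k)|
        + del * (1 + \sum_(n <= k < N) gamma k.+1)) ->
    (exists n0, forall n, (n0 <= n)%N -> K (theta n)) ->
    (forall n0, exists2 n, (n0 <= n)%N & V (theta n)) ->
    edist_set (theta n) C @[n --> \oo] --> (0 : R).
Proof.
move=> d0 e0 B0 u00 [df cg] cC cK oD AD Ccrit Cargmin argmin_crit.
have cf : continuous f by move=> x; exact: differentiable_continuous.
pose A := C `&` K.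
have cA : compact A by rewrite /A setIC; exact: compact_closedI.
have [A0|/set0P[a0 Aa0]] := eqVneq A set0.
  exists set0; split=> [x|]; first by rewrite -/A A0.
  by move=> theta gamma _ _ _ _ _ _ /(_ 0%N)[].
have a0D : closure D a0 by apply: subset_closure; exact: AD.
pose fs := f a0.
have fmin x : closure D x -> fs <= f x.
  have : argmin_on f (closure D) a0 by rewrite -Cargmin; split=> //; case: Aa0.
  by case=> _ H; exact: H.
have fCmin x : closure D x -> f x <= fs -> C x.
  move=> Dx fx; suff : (C `&` closure D) x by case.
  rewrite Cargmin; split=> // y Dy; exact: le_trans fx (fmin _ Dy).
have gCmin x : closure D x -> grad f x = 0 -> C x.
  move=> Dx gx; suff : (C `&` closure D) x by case.
  by rewrite Cargmin argmin_crit.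
have fC x : closure D x -> C x -> f x = fs.
  move=> Dx Cx; apply/eqP; rewrite eq_le fmin// andbT.
  have : (C `&` closure D) x by [].
  by rewrite Cargmin => -[_]; exact.
have cng : continuous (fun x => `|grad f x|).
  by move=> x; apply: (@continuous_comp _ _ _ (grad f)); [exact: cg|exact: norm_continuous].
pose W0 := D `&` [set x | `|grad f x| < u0].
have oW0 : open W0.
  apply: openI => //; apply: (open_comp _ (@open_lt _ u0)) => x _; exact: cng.
have AW0 : A `<=` W0.
  by move=> x Ax; split; [exact: AD|rewrite /= Ccrit ?normr0//; case: Ax].
have [r2 r20 r2W0] := compact_thickening cA oW0 AW0.
pose r := r2 / 2.
have r0 : 0 < r by rewrite divr_gt0.
pose O_ s := \bigcup_(a in A) ball a s.
have oO s : open (O_ s) by apply: bigcup_open => a _; exact: ball_open.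
pose Q s := K `&` closure D `&` ~` O_ s.
have cQ s : compact (Q s).
  rewrite /Q -setIA; apply: compact_closedI => //.
  apply: closedI; first exact: closed_closure.
  exact: open_closedC.
have gapQ s : 0 < s -> exists2 h, 0 < h & forall x, Q s x -> fs + h <= f x.
  move=> s0; apply: compact_gap => // x [[Kx Dx] nOx].
  rewrite ltNge; apply/negP => /(fCmin _ Dx) Cx; apply: nOx.
  by exists x; [split|exact: ballxx].
have [h2 h20 h2P] := gapQ r r0.
pose h := h2 / 2.
have h0 : 0 < h by rewrite divr_gt0.
exists (O_ r `&` [set x | f x < fs + h]); split.
  move=> x Ax; apply: open_nbhs_nbhs; split.
    apply: openI; first exact: oO.
    by apply: (open_comp _ (@open_lt _ (fs + h))) => y _; exact: cf.
  split; first by exists x => //; exact: ballxx.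
  by rewrite /= (fC x) ?ltrDl//; [apply: subset_closure; exact: AD|case: Ax].
move=> theta gamma gpos gcvg gsum step drift evK ioV.
have W0D x : W0 x -> closure D x by case=> Dx _; exact: subset_closure.
(* a point of [W0] where [f] is small is far from the boundary of [W0] *)
have deep x y : K x -> W0 x -> f x < fs + h2 -> `|y - x| < r -> W0 y.
  move=> Kx Wx fx yx.
  have : O_ r x.
    apply: contrapT => nO; move: fx; rewrite ltNge => /negP; apply; apply: h2P.
    by split=> //; split=> //; exact: W0D.
  move=> [a Aa]; rewrite -ball_normE /= => ax; apply: (r2W0 a) => //.
  rewrite -(subrKA x) /r [r2]splitr (le_lt_trans (ler_normD _ _))// ltrD//.
  by rewrite distrC.
have key h' : 0 < h' -> h' <= h -> exists n0, forall n, (n0 <= n)%N ->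
    [/\ K (theta n), W0 (theta n) & f (theta n) <= fs + 2 * h'].
  move=> h'0 h'h.
  (* critical points of [closure D] are minimizers, so the gradient is bounded below
     on the part of [K] where [f] is not yet small *)
  pose L := K `&` closure D `&` [set x | fs + h' / 2 <= f x].
  have cL : compact L.
    rewrite /L -setIA; apply: compact_closedI => //.
    apply: closedI; first exact: closed_closure.
    apply: (preimage_closed _ (@closed_ge _ (fs + h' / 2))) => x _; exact: cf.
  have [rho rho0 rhoP] : exists2 rho, 0 < rho & forall x, L x -> rho <= `|grad f x|.
    have [|rho rho0 H] := compact_gap cng cL (c := 0); last first.
      by exists rho => // x Lx; have := H x Lx; rewrite add0r.
    move=> x [[Kx Dx] fx]; rewrite normr_gt0; apply/eqP => /(gCmin _ Dx)/(fC _ Dx) fE.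
    by move: fx; rewrite /= fE; lra.
  have dR : 0 < d%:R :> R by rewrite ltr0n.
  pose c1 := u0 * (d%:R + 1) / eps + d%:R * B.
  have c10 : 0 < c1 by rewrite addr_gt0 ?mulr_gt0 ?invr_gt0 ?addr_gt0.
  (* the oscillation may cost a quarter of the guaranteed decrease *)
  pose w := rho ^+ 2 / (8 * eps) / c1.
  have w0 : 0 < w by rewrite !divr_gt0 ?exprn_gt0 ?mulr_gt0.
  have [rw rw0 rwP] := compact_unif_continuous cg cK w0.
  pose c2 := d%:R * B * (u0 + w).
  have c20 : 0 < c2 by rewrite !mulr_gt0// addr_gt0.
  (* windows last between [T] and [2 * T], during which the iterates move by at
     most [2 * B * T]: less than the radius of uniform continuity, less than the
     depth [r], and so little that [f] varies by at most [h' / 4] *)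
  pose T := Num.min (Num.min (rw / (4 * B)) (r / (4 * B))) (h' / (8 * c2)).
  have B4 : 0 < 4 * B by rewrite mulr_gt0.
  have c28 : 0 < 8 * c2 by rewrite mulr_gt0.
  have T0 : 0 < T.
    by rewrite /T !lt_min (divr_gt0 rw0 B4) (divr_gt0 r0 B4) (divr_gt0 h'0 c28).
  have Trw : 2 * B * T < rw.
    apply: (@le_lt_trans _ _ (2 * B * (rw / (4 * B)))).
      by rewrite ler_wpM2l ?mulr_ge0 ?(ltW B0)// /T !ge_min lexx.
    have -> : 2 * B * (rw / (4 * B)) = rw / 2 by field; exact: lt0r_neq0.
    lra.
  have Tr : 2 * B * T < r.
    apply: (@le_lt_trans _ _ (2 * B * (r / (4 * B)))).
      by rewrite ler_wpM2l ?mulr_ge0 ?(ltW B0)// /T !ge_min lexx orbT.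
    have -> : 2 * B * (r / (4 * B)) = r / 2 by field; exact: lt0r_neq0.
    lra.
  have Th : 2 * c2 * T <= h' / 4.
    apply: (@le_trans _ _ (2 * c2 * (h' / (8 * c2)))).
      have T3 : T <= h' / (8 * c2) by rewrite /T ge_min lexx orbT.
      by apply: ler_wpM2l => //; rewrite mulr_ge0// ltW.
    by rewrite le_eqVlt; apply/orP; left; apply/eqP; field; exact: lt0r_neq0.
  (* the noise over one window may cost another quarter of the decrease *)
  pose del := T * rho ^+ 2 / (8 * eps) / (d%:R * u0 * (1 + 2 * T)).
  have T1 : 0 < 1 + 2 * T by lra.
  have del0 : 0 < del by rewrite !divr_gt0 ?mulr_gt0 ?exprn_gt0.
  have [n1 drift1] := drift del del0.
  have [n2 K2] := evK.
  have /cvgrPdist_lt/(_ T T0)[n3 _ g3] := gcvg.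
  pose n0 := maxn n1 (maxn n2 n3).
  have g3' k : (n0 <= k)%N -> gamma k.+1 <= T.
    rewrite !geq_max => /and3P[_ _ k3]; apply: le_trans (ler_norm _) _.
    by have := g3 k.+1 (leqW k3); rewrite sub0r normrN => /ltW.
  have Kn k : (n0 <= k)%N -> K (theta k).
    by rewrite !geq_max => /and3P[_ k2 _]; exact: K2.
  have winex n : exists N, (n0 <= n)%N ->
     [/\ (n < N)%N, T <= \sum_(n <= k < N) gamma k.+1 &
      \sum_(n <= k < N) gamma k.+1 <= 2 * T].
    have [nn|nn] := leqP n0 n; last by exists 0%N.
    have [|N HN] := window_exists gpos gsum (n := n) T0; last by exists N.
    by move=> k nk; apply: g3'; exact: leq_trans nk.
  have [N HN] := choice winex.
  have g0' k : 0 < gamma k.+1 by rewrite gpos.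
  pose c := T * rho ^+ 2 / (4 * eps).
  have c0 : 0 < c by rewrite divr_gt0 ?mulr_gt0 ?exprn_gt0.
  have window n : (n0 <= n)%N -> W0 (theta n) -> f (theta n) <= fs + h ->
    (forall k, (n <= k <= N n)%N -> W0 (theta k) /\ f (theta k) <= f (theta n) + h' / 4) /\
    f (theta (N n)) <= Num.max (fs + h') (f (theta n) - c).
    move=> nn Wn fn; have [nN TN NT] := HN n nn.
    have near_n k : (n <= k <= N n)%N -> `|theta k - theta n| <= B * \sum_(n <= i < N n) gamma i.+1.
      move=> /andP[nk kN]; apply: (le_trans (increment_sum_le step nk)).
      rewrite ler_wpM2l ?(ltW B0)// [leRHS](big_cat_nat nk kN)//= lerDl.
      by apply: sumr_ge0 => i _; exact: ltW.
    set t := \sum_(n <= i < N n) gamma i.+1 in TN NT near_n *.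
    have t0 : 0 < t by exact: lt_le_trans TN.
    have Bt : B * t <= 2 * B * T by rewrite -mulrA mulrCA ler_wpM2l ?(ltW B0).
    have inW k : (n <= k <= N n)%N -> W0 (theta k).
      move=> kN; apply: (deep (theta n)) => //; first exact: Kn.
        by apply: (le_lt_trans fn); rewrite /h; lra.
      by apply: le_lt_trans Tr; exact: le_trans (near_n k kN) Bt.
    have osc z : `|z - theta n| <= B * t -> `|grad f z - grad f (theta n)| <= w.
      move=> zn; apply/ltW/rwP; first exact: Kn.
      by apply: le_lt_trans Trw; exact: le_trans zn Bt.
    have un : `|grad f (theta n)| <= u0 by case: Wn => _ /ltW.
    have vary k : (n <= k <= N n)%N -> `|f (theta k) - f (theta n)| <= h' / 4.
      move=> kN; have vk := near_n k kN.
      have [s s01 fE] := mean_value_grad (theta n) (theta k - theta n) df.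
      have -> : f (theta k) - f (theta n) = f (theta n + (theta k - theta n)) - f (theta n).
        by rewrite (addrC (theta n)) subrK.
      rewrite fE (le_trans (ler_norm_sum _ _ _))//.
      apply: (@le_trans _ _ (\sum_(j < d) (u0 + w) * (2 * B * T))).
        apply: ler_sum => j _; rewrite normrM ler_pM//.
          apply: (le_trans (rV_coord_le _ _)).
          rewrite -(subrK (grad f (theta n)) (grad f _)) (le_trans (ler_normD _ _))//.
          rewrite addrC lerD//; apply: osc; rewrite addrAC subrr add0r normrZ.
          apply: le_trans vk; case/andP: s01 => s0 s1.
          by rewrite ger0_norm// ler_piMl.
        exact: (le_trans (rV_coord_le _ _) (le_trans vk Bt)).
      rewrite sumr_const card_ord -[leLHS]mulr_natl; apply: le_trans Th.
      by rewrite /c2 le_eqVlt; apply/orP; left; apply/eqP; ring.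
    have varyN : (n <= N n <= N n)%N by rewrite leqnn ltnW.
    split.
      move=> k kN; split; first exact: inW.
      by have := vary k kN; rewrite ler_norml => /andP[_]; lra.
    have [big|small] := leP (fs + h' / 2) (f (theta n)); last first.
      rewrite le_max; apply/orP; left.
      by have := vary (N n) varyN; rewrite ler_norml => /andP[_]; lra.
    have un' : rho <= `|grad f (theta n)|.
      by apply: rhoP; split=> //; split; [exact: Kn|exact: W0D].
    rewrite le_max; apply/orP; right.
    have dr : forall j, `|theta (N n) ord0 j - theta n ord0 j
               + eps^-1 * \sum_(n <= k < N n) gamma k.+1 * grad f (theta k) ord0 j|
         <= (2 * eps * d%:R)^-1 * \sum_(n <= k < N n) gamma k.+1 * `|grad f (theta k)|
        + del * (1 + t).
      apply: drift1; [|exact: ltnW|].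
        by move: nn; rewrite !geq_max => /and3P[].
      move=> k nk kN.
      have [Dk uk] : W0 (theta k) by apply: inW; rewrite nk ltnW.
      by split=> //; apply: Kn; exact: leq_trans nk.
    have := window_descent d0 e0 (ltW B0) df g0' step (ltnW nN) dr osc.
    rewrite -/t; set u := `|grad f (theta n)| in un un' *.
    move=> H.
    have u0' : 0 <= u by exact: normr_ge0.
    have E1 : t * w * (u * (d%:R + 1) / eps + d%:R * B) <= t * (rho ^+ 2 / (8 * eps)).
      have -> : rho ^+ 2 / (8 * eps) = w * c1 by rewrite /w divfK// lt0r_neq0.
      rewrite -mulrA !ler_wpM2l ?(ltW t0) ?(ltW w0)//.
      rewrite /c1 lerD2r ler_wpM2r ?invr_ge0 ?(ltW e0)// ler_wpM2r// addr_ge0// ltW.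
    have E2 : d%:R * u * (del * (1 + t)) <= T * rho ^+ 2 / (8 * eps).
      have -> : T * rho ^+ 2 / (8 * eps) = d%:R * u0 * (del * (1 + 2 * T)).
        by rewrite /del; field; rewrite !lt0r_neq0.
      have dn := ltW dR; have deln := ltW del0; have tn := ltW t0.
      apply: ler_pM; first exact: mulr_ge0.
      - by apply: mulr_ge0 => //; apply: addr_ge0.
      - by apply: ler_wpM2l.
      - by apply: ler_wpM2l => //; rewrite lerD2l.
    have E3 : t / (2 * eps) * rho ^+ 2 <= t / (2 * eps) * u ^+ 2.
      rewrite ler_wpM2l ?divr_ge0 ?mulr_ge0 ?(ltW t0) ?(ltW e0)//.
      by rewrite ler_pXn2r ?nnegrE// ltW.
    have E4 : T * (rho ^+ 2 / (8 * eps)) <= t * (rho ^+ 2 / (8 * eps)).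
      by rewrite ler_wpM2r// divr_ge0 ?sqr_ge0// mulr_ge0// ltW.
    have E5 : t / (2 * eps) * rho ^+ 2 = 4 * (t * (rho ^+ 2 / (8 * eps))).
      by field; rewrite lt0r_neq0.
    have E6 : c = 2 * (T * (rho ^+ 2 / (8 * eps))) by rewrite /c; field; rewrite lt0r_neq0.
    have E7 : T * rho ^+ 2 / (8 * eps) = T * (rho ^+ 2 / (8 * eps)) by rewrite mulrA.
    rewrite E6; rewrite E7 in E2; rewrite mulNr in H.
    set X1 := t * (rho ^+ 2 / (8 * eps)) in E1 E4 E5 *.
    set X2 := T * (rho ^+ 2 / (8 * eps)) in E2 E4 *.
    rewrite E5 in E3.
    lra.
  have [ns nsn0 [nsO nsf]] := ioV n0.
  (* consecutive windows, from a visit of [V] on *)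
  pose a i := iter i N ns.
  have nsW : W0 (theta ns).
    move: nsO => [b Ab]; rewrite -ball_normE /= => bx; apply: (r2W0 b) => //.
    by rewrite distrC (lt_trans bx)// /r ltr_pdivrMr// ltr_pMr// ltr1n.
  have chain i : [/\ (n0 <= a i)%N, W0 (theta (a i)), f (theta (a i)) <= fs + h &
      f (theta (a i)) <= Num.max (fs + h') (fs + h - c *+ i)].
    elim: i => [|i [ai Wi fi mi]].
      by split=> //; rewrite ?(ltW nsf)// le_max mulr0n subr0 (ltW nsf) orbT.
    have [wk wN] := window (a i) ai Wi fi.
    have [aN _ _] := HN (a i) ai.
    have aiN : (a i <= N (a i) <= N (a i))%N by rewrite leqnn ltnW.
    have fS : f (theta (a i.+1)) <= Num.max (fs + h') (fs + h - c *+ i.+1).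
      apply: (le_trans wN); rewrite ge_max le_max lexx /=.
      move: mi; rewrite !le_max => /orP[|] mi; apply/orP; [left|right].
        by lra.
      rewrite mulrSr; lra.
    split=> //.
    - by rewrite /a iterS (leq_trans ai)// ltnW.
    - by have [] := wk _ aiN.
    - apply: (le_trans fS); rewrite ge_max lerD2l h'h /=.
      by rewrite lerBlDr lerDl mulrn_wge0// ltW.
  have [I HI] : exists I, forall i, (I <= i)%N -> f (theta (a i)) <= fs + h'.
    have hc : 0 <= h / c by rewrite divr_ge0// ltW.
    have := archi_boundP hc; set I := Num.bound _ => hI.
    exists I => i Ii; have [_ _ _] := chain i; rewrite le_max => /orP[//|].
    move/le_trans; apply; rewrite lerBlDr -addrA lerD2l.
    have : h <= c *+ i.
      rewrite -mulr_natr mulrC -ler_pdivrMr// (le_trans (ltW hI))//.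
      by rewrite ler_nat.
    lra.
  exists (a I) => k ak.
  have [i||i Ii /andP[aik kai]] := iterated_windows (a := a) (I := I) (k := k) => //.
    by have [ai _ _ _] := chain i; have [] := HN (a i) ai.
  have [ai Wi fi _] := chain i.
  have [wk _] := window (a i) ai Wi fi.
  have [Wk fk] : W0 (theta k) /\ f (theta k) <= f (theta (a i)) + h' / 4.
    by apply: wk; rewrite aik.
  split=> //; first by apply: Kn; exact: leq_trans aik.
  have := HI i Ii; lra.
apply/cvgrPdist_le => e e0'.
pose s := e / d%:R.
have dR : 0 < d%:R :> R by rewrite ltr0n.
have s0 : 0 < s by rewrite divr_gt0.
have [hs hs0 hsP] := gapQ s s0.
pose h' := Num.min h (hs / 4).
have h'0 : 0 < h' by rewrite lt_min h0 divr_gt0.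
have [|n0 Hn] := key h' h'0; first by rewrite ge_min lexx.
exists n0 => // n /= nn; have [Kn Wn fn] := Hn n nn.
have : O_ s (theta n).
  apply: contrapT => nO.
  have : fs + hs <= f (theta n) by apply: hsP; split=> //; split=> //; exact: W0D.
  have : h' <= hs / 4 by rewrite ge_min lexx orbT.
  lra.
move=> [a Aa]; rewrite -ball_normE /= => /ltW ax.
have Ca : C a by case: Aa.
have /andP[dist0 dista] := edist_set_le (theta n) Ca.
rewrite sub0r normrN ger0_norm// (le_trans dista)// (le_trans (enorm_le_norm _))//.
by rewrite mulrC -ler_pdivlMr// distrC.
Qed.

(** * The drift of Adam over windows *)

(** The fluctuation property that [noise_drift_le] provides: the running time
[\sum gamma k.+1] of the window appears on the right so that one rank serves windows of
every length. *)
Definition window_sums_negligible (R : realType) (gamma : nat -> R)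
    (good : nat -> Prop) (y : nat -> R) : Prop :=
  forall del, 0 < del -> exists n0, forall n N, (n0 <= n)%N -> (n <= N)%N ->
    (forall k, (n <= k)%N -> (k < N)%N -> good k) ->
    \sum_(n <= k < N) gamma k.+1 * y k <= del * (1 + \sum_(n <= k < N) gamma k.+1).

(** Per coordinate, a step of Adam is [gamma / eps * m] up to a discounted sum of
tempered squares.  Over a window the momentum is exchanged for the innovation by
[momentum_sum_error], the discounted sum for its last term by
[discounted_weighted_sum]; the innovation and its tempered square are then replaced
by their conditional means. *)
Lemma adam_drift (R : realType) (a b eps s A B eta : R)
    (gamma th x m v G H : nat -> R) (good : nat -> Prop) :
  0 < eps -> 0 <= a -> a < 1 -> 0 < b -> b < 1 -> 0 < s <= 1 -> 0 <= A -> 0 < B ->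
  (forall n, (0 < n)%N -> 0 < gamma n) ->
  (forall n k, (0 < n)%N -> (n <= k)%N -> gamma k <= gamma n) ->
  gamma n @[n --> \oo] --> (0 : R) ->
  m 0%N = 0 -> (forall n, m n.+1 = a * m n + (1 - a) * x n) ->
  (forall n, `|m n.+1 / eps - v n.+1| <= B / eps * discounted_sum (Num.sqrt b)
           (fun k => tempered_sqr ((1 - Num.sqrt b) * eps) (x k)) n.+1) ->
  (forall n, th n.+1 = th n + gamma n.+1 * v n.+1) ->
  (forall n, `|x n| <= A * gamma n.+1 `^ (s - 1)) ->
  window_sums_negligible gamma good (fun k => x k + G k) ->
  window_sums_negligible gamma good (fun k => - x k - G k) ->
  window_sums_negligible gamma good
    (fun k => tempered_sqr ((1 - Num.sqrt b) * eps) (x k) - eta * H k) ->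
  forall del, 0 < del -> exists n0, forall n N, (n0 <= n)%N -> (n <= N)%N ->
      (forall k, (n <= k)%N -> (k < N)%N -> good k) ->
      `|th N - th n + eps^-1 * \sum_(n <= k < N) gamma k.+1 * G k|
        <= B / eps / (1 - Num.sqrt b) * eta * \sum_(n <= k < N) gamma k.+1 * H k
           + del * (1 + \sum_(n <= k < N) gamma k.+1).
Proof.
move=> e0 a0 a1 b0 b1 s01 A0 B0 gpos gdecr gcvg m0 mS lin thS xA nx1 nx2 nh del del0.
set sb := Num.sqrt b in lin nh *.
have sb0 : 0 <= sb by exact: sqrtr_ge0.
have sb1 : sb < 1 by rewrite -[ltRHS]sqrtr1 ltr_sqrt.
have sb10 : 0 < 1 - sb by rewrite subr_gt0.
pose y k := tempered_sqr ((1 - sb) * eps) (x k).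
have c0 : 0 < (1 - sb) * eps by rewrite mulr_gt0.
have yA k : 0 <= y k <= A * gamma k.+1 `^ (s - 1).
  by rewrite tempered_sqr_ge0//= (le_trans (tempered_sqr_le_norm _ c0)).
pose k1 := eps^-1 + B / eps / (1 - sb).
have Be : 0 < B / eps / (1 - sb) by rewrite !divr_gt0.
have k10 : 0 < k1 by rewrite addr_gt0// invr_gt0.
pose c3 := eps^-1 * (a / (1 - a) * A * (2 + s^-1)) + B / eps / (1 - sb) * (A / (1 - sb)) + 1.
have s0 : 0 < s by case/andP: s01.
have c30 : 0 < c3.
  have ei : 0 <= eps^-1 by rewrite invr_ge0 ltW.
  have a10 : 0 <= a / (1 - a) by rewrite divr_ge0// subr_ge0 ltW.
  have s2 : 0 <= 2 + s^-1 by rewrite addr_ge0// invr_ge0 ltW.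
  have A1 : 0 <= A / (1 - sb) by rewrite divr_ge0// ltW.
  have P1 := mulr_ge0 ei (mulr_ge0 (mulr_ge0 a10 A0) s2).
  have P2 := mulr_ge0 (ltW Be) A1.
  by rewrite ltr_wpDl// addr_ge0.
pose del' := del / (2 * k1).
have del'0 : 0 < del' by rewrite divr_gt0// mulr_gt0.
have [n1 H1] := nx1 _ del'0; have [n2 H2] := nx2 _ del'0; have [n3 H3] := nh _ del'0.
have [n4 H4] := powR_eventually_le gpos gcvg s0 (divr_gt0 del0 (mulr_gt0 (ltr0Sn R 1) c30)).
exists (maxn (maxn n1 n2) (maxn n3 n4.+1)) => n N.
rewrite !geq_max => /andP[/andP[nn1 nn2] /andP[nn3 nn4]] nN good_nN.
have n_gt0 : (0 < n)%N by exact: leq_trans nn4.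
have {}H1 := H1 n N nn1 nN good_nN; have {}H2 := H2 n N nn2 nN good_nN.
have {}H3 := H3 n N nn3 nN good_nN; have {}H4 := H4 n nn4.
set t := \sum_(n <= k < N) gamma k.+1 in H1 H2 H3 *.
have t0 : 0 <= t by apply: sumr_ge0 => k _; rewrite ltW// gpos.
have Hm := momentum_sum_error a0 a1 s01 A0 gpos gdecr m0 mS xA n_gt0 nN.
have Hq := discounted_weighted_sum sb0 sb1 s01 A0 gpos gdecr yA n_gt0 nN.
set Sq := \sum_(_ <= _ < _) _ in Hq.
set Sm := \sum_(_ <= _ < _) _ in Hm.
set SH := \sum_(n <= k < N) gamma k.+1 * H k.
set SG := \sum_(n <= k < N) gamma k.+1 * G k.
pose Sx := \sum_(n <= k < N) gamma k.+1 * (x k + G k).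
pose Sy := \sum_(n <= k < N) gamma k.+1 * y k.
pose Se := \sum_(n <= k < N) gamma k.+1 * (m k.+1 / eps - v k.+1).
have thE : th N - th n + eps^-1 * SG = eps^-1 * Sm + eps^-1 * Sx - Se.
  rewrite -telescope_sumr// /SG /Sm /Sx /Se !mulr_sumr -!big_split/= -sumrB.
  by apply: eq_big_nat => k _; rewrite thS; field; exact: lt0r_neq0.
have SeB : `|Se| <= B / eps * Sq.
  rewrite /Se /Sq mulr_sumr; apply: (le_trans (ler_norm_sum _ _ _)).
  apply: ler_sum => k _; rewrite normrM gtr0_norm ?gpos// mulrCA.
  by rewrite ler_wpM2l ?lin// ltW// gpos.
have SxB : `|Sx| <= del' * (1 + t).
  rewrite ler_norml H1 andbT lerNl; apply: le_trans H2.
  by rewrite /Sx -sumrN le_eqVlt; apply/orP; left; apply/eqP; apply: eq_bigr => k _; ring.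
have SyB : Sy <= eta * SH + del' * (1 + t).
  rewrite -lerBlDl; apply: le_trans H3.
  rewrite /Sy /SH mulr_sumr -sumrB le_eqVlt; apply/orP; left; apply/eqP.
  by apply: eq_bigr => k _; rewrite /y; ring.
rewrite thE; apply: (le_trans (ler_normB _ _)).
apply: (le_trans (lerD (ler_normD _ _) (le_refl _))).
have ei : 0 <= eps^-1 by rewrite invr_ge0 ltW.
rewrite !normrM (ger0_norm ei).
have Q1 : B / eps * Sq <= B / eps / (1 - sb) * (Sy + A / (1 - sb) * gamma n `^ s).
  have -> : B / eps * Sq = B / eps / (1 - sb) * ((1 - sb) * Sq).
    by field; rewrite !lt0r_neq0.
  by rewrite ler_wpM2l// ltW.
have Q2 := ler_wpM2l (ltW Be) SyB.
have Q3 := ler_wpM2l ei SxB.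
have Q4 := ler_wpM2l ei Hm.
have Q5 : c3 * gamma n `^ s <= del / 2.
  have := ler_wpM2l (ltW c30) H4.
  have -> : c3 * (del / (2 * c3)) = del / 2 by field; exact: lt0r_neq0.
  by [].
have Q6 : k1 * (del' * (1 + t)) = del / 2 * (1 + t).
  by rewrite /del'; field; exact: lt0r_neq0.
have gs0 := powR_ge0 (gamma n) s.
move: Q5 Q6; rewrite /c3 /k1 => Q5 Q6.
have Q7 := mulr_ge0 (ltW del0) t0.
move: Q1 Q2 Q3 Q4 Q5 Q6 SeB; rewrite !mulrDr !mulrDl !mul1r !mulr1 -!mulrA.
lra.
Qed.

(** * Moments of the innovation *)

Lemma measurable_tempered_sqr (R : realType) (c : R) :
  0 < c -> measurable_fun [set: R] (tempered_sqr c).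
Proof.
move=> c0; rewrite (_ : tempered_sqr c = (fun y => y ^+ 2 * (`|y| + c) `^ (-1))); last first.
  by apply/funext => y; rewrite /tempered_sqr powR_inv1// addr_ge0// ltW.
apply: measurable_funM; first exact: measurable_funX.
apply: (measurableT_comp (measurable_powR (-1))); apply: measurable_funD => //.
Qed.

(** Splits according to [`|Y| <= rho]: [y ^+ 2 <= rho ^+ 2 + `|y| ^+ 3 / rho]. *)
Lemma integral_tempered_sqr_le (dO : measure_display) (Omega : measurableType dO)
    (R : realType) (P : probability Omega R) (Y : Omega -> R) (c M rho : R) :
  0 < c -> 0 < rho -> measurable_fun setT Y ->
  (\int[P]_w (`|Y w| ^+ 3)%:E <= M%:E)%E ->
  (\int[P]_w (tempered_sqr c (Y w))%:E <= ((rho ^+ 2 + M / rho) / c)%:E)%E.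
Proof.
move=> c0 r0 mY YM.
have mY3 : measurable_fun setT (fun w => `|Y w| ^+ 3).
  by apply: measurable_funX; exact: measurableT_comp.
have mH : measurable_fun setT (fun w => tempered_sqr c (Y w)).
  exact: (measurableT_comp (measurable_tempered_sqr c0)).
have pw y : tempered_sqr c y <= rho ^+ 2 / c + (rho * c)^-1 * `|y| ^+ 3.
  apply: (le_trans (tempered_sqr_le_sqr _ c0)).
  rewrite -(real_normK (num_real y)) invfM.
  have -> : rho ^+ 2 / c + rho^-1 * c^-1 * `|y| ^+ 3 = (rho ^+ 2 + `|y| ^+ 3 / rho) / c.
    by field; rewrite !lt0r_neq0.
  rewrite ler_pM2r ?invr_gt0//.
  have [yr|/ltW ry] := leP `|y| rho.
    rewrite (@le_trans _ _ (rho ^+ 2))//; first by rewrite ler_pXn2r ?nnegrE// ltW.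
    by rewrite lerDl divr_ge0// ?exprn_ge0// ltW.
  rewrite (@le_trans _ _ (`|y| ^+ 3 / rho))//; last by rewrite lerDr sqr_ge0.
  by rewrite ler_pdivlMr// [leRHS]exprSr ler_wpM2l// exprn_ge0.
have k0 : 0 <= (rho * c)^-1 by rewrite invr_ge0 mulr_ge0 ?(ltW c0) ?(ltW r0).
have k1 : 0 <= rho ^+ 2 / c by rewrite divr_ge0 ?sqr_ge0 ?(ltW c0).
apply: (@le_trans _ _ (\int[P]_w ((rho ^+ 2 / c)%:E + (rho * c)^-1%:E * (`|Y w| ^+ 3)%:E))%E).
  apply: ge0_le_integral => //.
  - by move=> w _; rewrite lee_fin tempered_sqr_ge0.
  - exact/measurable_EFinP.
  - apply/measurable_EFinP; apply: measurable_funD => //; exact: measurable_funM.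
  - by move=> w _; rewrite -EFinM -EFinD lee_fin.
rewrite ge0_integralD//=; first last.
- by apply/measurable_EFinP; exact: measurable_funM.
- by move=> w _; rewrite -EFinM lee_fin mulr_ge0// exprn_ge0.
rewrite ge0_integralZl//=; last exact/measurable_EFinP.
rewrite integral_cst// [X in (_ * X + _)%E](_ : _ = 1%E); last exact: probability_setT.
rewrite mule1 mulrDl EFinD leeD2l//.
have -> : M / rho / c = (rho * c)^-1 * M by field; rewrite !lt0r_neq0.
by rewrite EFinM lee_wpmul2l.
Qed.

(** Optimizes [rho] as a power of [u]: the exponents of [rho ^+ 2] and of
[u ^ p1 / rho] both exceed one exactly because [p1 > 3 / 2], which leaves a spare
positive power of [u] to absorb the constants. *)
Lemma tempered_sqr_moment_le (R : realType) (p1 C1 c eta : R) :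
  3 / 2 < p1 -> 0 < C1 -> 0 < c -> 0 < eta ->
  exists2 u1, 0 < u1 & forall (dO : measure_display) (Omega : measurableType dO)
    (P : probability Omega R) (Y : Omega -> R) (u : R),
    measurable_fun setT Y -> 0 <= u -> u <= u1 ->
    (\int[P]_w (`|Y w| ^+ 3)%:E <= (C1 * u `^ p1)%:E)%E ->
    (\int[P]_w (tempered_sqr c (Y w))%:E <= (eta * u)%:E)%E.
Proof.
move=> p1_gt C10 c0 eta0.
pose e := p1 / 2 - 3 / 4.
have e0 : 0 < e by rewrite /e; lra.
have q0 : 0 < c * eta / (1 + C1) by rewrite divr_gt0 ?mulr_gt0 ?addr_gt0.
exists (Num.min 1 ((c * eta / (1 + C1)) `^ e^-1)).
  by rewrite lt_min ltr01 powR_gt0.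
move=> dO Omega P Y u mY; rewrite le_eqVlt => /predU1P[<- _|u0].
  rewrite powR0 ?gt_eqF//; last by lra.
  rewrite !mulr0 => Y3; apply/lee_addgt0Pr => r r0; rewrite add0e.
  have cr0 : 0 < Num.sqrt (c * r) by rewrite sqrtr_gt0 mulr_gt0.
  apply: (le_trans (integral_tempered_sqr_le c0 cr0 mY Y3)).
  rewrite mul0r addr0 sqr_sqrtr ?mulr_ge0 ?(ltW c0) ?(ltW r0)// lee_fin.
  by rewrite mulrAC divff ?mul1r// lt0r_neq0.
rewrite le_min => /andP[u1 ue] Y3.
have ue' : u `^ e <= c * eta / (1 + C1).
  have := ge0_ler_powR (ltW e0) _ _ ue; rewrite !nnegrE (ltW u0) powR_ge0.
  by move=> /(_ isT isT); rewrite -powRrM mulVf ?gt_eqF// powRr1// ltW.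
have ra : 0 < u `^ (e + 2^-1) by exact: powR_gt0.
apply: (le_trans (integral_tempered_sqr_le c0 ra mY Y3)); rewrite lee_fin.
have ne : u != 0 by exact: lt0r_neq0.
have pD y z : u `^ (y + z) = u `^ y * u `^ z by rewrite powRD// ne implybT.
have E1 : (u `^ (e + 2^-1)) ^+ 2 = u * (u `^ e * u `^ e).
  rewrite -powR_mulrn; last exact: powR_ge0.
  rewrite -powRrM.
  rewrite -{2}[u](powRr1 (ltW u0)) -!pD; congr (_ `^ _); by field.
have E2 : C1 * u `^ p1 / u `^ (e + 2^-1) = C1 * (u * u `^ e).
  rewrite -mulrA; congr (_ * _); rewrite -powRN -pD.
  rewrite -{2}[u](powRr1 (ltW u0)) -pD; congr (_ `^ _).
  by rewrite /e; field.
rewrite E1 E2 ler_pdivrMr//.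
have ue1 : u `^ e <= 1.
  by rewrite -(powRr0 u); apply: ger_powR; rewrite ?u0 ?u1 ?ltW.
have ue0 := powR_ge0 u e.
move: ue'; rewrite ler_pdivlMr; last by lra.
move=> H.
have : u `^ e * u `^ e <= u `^ e * 1 by rewrite ler_wpM2l.
move=> H2; have := ler_wpM2l (ltW u0) H2; have := ler_wpM2l (ltW u0) H.
lra.
Qed.

Lemma moment_bounded_on_compact (dO dS : measure_display)
    (Omega : measurableType dO) (S : measurableType dS) (R : realType)
    (P : probability Omega R) (d : nat) (p : R)
    (X : S -> 'rV[R]_d -> 'rV[R]_d) (U : {RV P >-> S}) (K : set 'rV[R]_d) :
  0 < p -> product_measurable X -> locally_regular p X U -> compact K ->
  exists2 V, 0 <= V & forall x j, K x ->
    (\int[P]_w (`|X (U w) x ord0 j| `^ p)%:E <= V%:E)%E.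
Proof.
move=> p0 mX [c [_ creg _]] cK.
have [M [_ KM]] := compact_bounded cK.
pose b := M + 1.
have bK x : K x -> `|x| <= `|b|.
  move=> Kx; apply: le_trans (ler_norm _).
  by have := KM b; rewrite ltrDl => /(_ ltr01 x Kx).
pose V := `|c 0| * (1 + expR (`|c 0| * (d%:R * `|b|))).
exists V; first by rewrite mulr_ge0// addr_ge0// expR_ge0.
move=> x j Kx.
have mcoord i : measurable_fun [set: Omega] (fun w => X (U w) x ord0 i).
  have mc : measurable_fun [set: borelRV R d] (fun x : borelRV R d => (x : 'rV[R]_d) ord0 i).
    by apply: measurable_borelRV => y; exact: coord_continuous.
  apply: (measurableT_comp mc); apply: (measurableT_comp mX
    (g := fun w : Omega => (U w, x : borelRV R d))).
  exact: measurable_fun_pair.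
have menorm : measurable_fun [set: Omega] (fun w => enorm (X (U w) x)).
  apply: (measurableT_comp (f := @Num.sqrt R)).
    by apply: continuous_measurable_fun; exact: sqrt_continuous.
  by apply: measurable_sum => i; exact: measurable_funX.
have := creg x; rewrite unlock => H.
apply: (@le_trans _ _ (\int[P]_w (enorm (X (U w) x) `^ p)%:E)%E).
  apply: ge0_le_integral => //.
  - apply/measurable_EFinP; apply: (measurableT_comp (measurable_powR p)).
    exact: measurableT_comp.
  - by apply/measurable_EFinP; exact: (measurableT_comp (measurable_powR p)).
  - move=> w _; rewrite lee_fin; apply: ge0_ler_powR; rewrite ?nnegrE ?(ltW p0) ?sqrtr_ge0//.
    exact: le_trans (rV_coord_le _ _) (norm_le_enorm _).
apply: (le_trans H); rewrite lee_fin /V.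
apply: (@le_trans _ _ (`|c 0| * (1 + expR (c 0 * enorm x)))).
  by rewrite ler_wpM2r ?ler_norm// addr_ge0// expR_ge0.
rewrite ler_wpM2l// lerD2l ler_expR.
apply: (@le_trans _ _ (`|c 0| * enorm x)).
  by rewrite ler_wpM2r ?ler_norm// sqrtr_ge0.
rewrite ler_wpM2l// (le_trans (enorm_le_norm _))// ler_wpM2l//.
exact: bK.
Qed.

(** * Convergence *)

Lemma noise_negligible_ae (dO dS : measure_display)
    (Omega : measurableType dO) (S : measurableType dS) (R : realType)
    (P : probability Omega R) (U : {RV P >-> S}) (Us : nat -> {RV P >-> S})
    (d : nat) (theta : nat -> Omega -> 'rV[R]_d) (gamma : nat -> R) (p V : R)
    (h : S -> 'rV[R]_d -> R) (mu : 'rV[R]_d -> R) (B : set 'rV[R]_d) :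
  iid_copies U Us ->
  (forall n, measurable_fun [set: past (fun k => Us k) n]
      (theta n : past (fun k => Us k) n -> borelRV R d)) ->
  (forall n, (0 < n)%N -> 0 < gamma n) ->
  (forall m n, (0 < m)%N -> (m <= n)%N -> gamma n <= gamma m) ->
  gamma n @[n --> \oo] --> (0 : R) ->
  (\sum_(1 <= n <oo) (gamma n `^ (1 + p / 3))%:E < +oo)%E ->
  measurable_fun [set: S * borelRV R d] (fun z : S * borelRV R d => h z.1 z.2) ->
  measurable_fun [set: borelRV R d] (mu : borelRV R d -> R) ->
  measurable (B : set (borelRV R d)) -> 2 <= p -> 0 <= V ->
  (forall x, B x -> [/\ (\int[P]_w (`|h (U w) x| `^ p)%:E <= V%:E)%E,
     (\int[P]_w (h (U w) x)%:E <= (mu x)%:E)%E & `|mu x| <= V]) ->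
  {ae P, forall w, window_sums_negligible gamma (fun k => B (theta k w))
     (fun k => h (Us k.+1 w) (theta k w) - mu (theta k w))}.
Proof.
move=> iid mtheta gpos gdecr gcvg gsum mh mmu mB p2 V0 hB.
have H i : {ae P, forall w, exists n0, forall n N, (n0 <= n)%N -> (n <= N)%N ->
     (forall k, (n <= k)%N -> (k < N)%N -> B (theta k w)) ->
     \sum_(n <= k < N) gamma k.+1 * (h (Us k.+1 w) (theta k w) - mu (theta k w))
       <= i.+1%:R^-1 * (1 + \sum_(n <= k < N) gamma k.+1)}.
  by apply: (noise_drift_le iid mtheta gpos gdecr gcvg gsum mh mmu mB p2 V0 _ hB); rewrite invr_gt0.
move/ae_foralln : H; apply: filterS => w H del del0.
have [i idel] : exists i : nat, i.+1%:R^-1 <= del.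
  have dn : 0 <= del^-1 by rewrite invr_ge0 ltW.
  exists (Num.bound del^-1); rewrite -[leRHS]invrK lef_pV2 ?posrE ?invr_gt0//.
  by rewrite (le_trans (ltW (archi_boundP dn)))// ler_nat.
have [n0 Hn] := H i; exists n0 => n N nn nN Bk.
apply: (le_trans (Hn n N nn nN Bk)); rewrite ler_wpM2r// addr_ge0//.
by apply: sumr_ge0 => k _; rewrite ltW// gpos.
Qed.

(** The first few terms only change the constant. *)
Lemma eventually_le_global (R : realType) (x y : nat -> R) :
  (forall n, 0 < y n) -> (exists n0, forall n, (n0 <= n)%N -> `|x n| <= y n) ->
  exists2 A, 0 <= A & forall n, `|x n| <= A * y n.
Proof.
move=> y0 [n0 H].
have S0 : 0 <= \sum_(k < n0) `|x k| / y k.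
  by apply: sumr_ge0 => k _; rewrite divr_ge0// ltW.
exists (1 + \sum_(k < n0) `|x k| / y k); first by rewrite addr_ge0.
move=> n; have [/H/le_trans|nn] := leqP n0 n.
  by apply; rewrite ler_peMl ?(ltW (y0 n))// lerDl.
rewrite -ler_pdivrMr// (bigD1 (Ordinal nn))//= addrCA lerDl addr_ge0//.
by apply: sumr_ge0 => k _; rewrite divr_ge0// ltW.
Qed.

Theorem theorem2p1 (R : realType)
  (eps alpha beta p : R)
  (eps_gt0 : 0 < eps)
  (alpha_ge0 : 0 <= alpha) (alpha_lt1 : alpha < 1)
  (beta_gt : alpha ^+ 2 < beta) (beta_lt1 : beta < 1)
  (p_ge2 : 2 <= p)
  (gamma : nat -> R)
  (gamma_gt0 : forall n, (0 < n)%N -> 0 < gamma n)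
  (gamma_decr : forall m n, (0 < m)%N -> (m <= n)%N -> gamma n <= gamma m)
  (gamma_cvg0 : gamma n @[n --> \oo] --> (0 : R))
  (gamma_nonsummable : (\sum_(1 <= n <oo) (gamma n)%:E = +oo)%E)
  (gamma_liminf :
    (0%:E < ereal_sup
      [set limn_einf (fun n => ((gamma n)^-1
           * gamma (n + `|Num.ceil ((gamma n)^-1 * e)|)%N)%:E)
       | e in [set e : R | (0 < e)%R]])%E)
  (gamma_summable : (\sum_(1 <= n <oo) (gamma n `^ (1 + p / 3))%:E < +oo)%E)
  (d : nat) (d_gt0 : (0 < d)%N) (x0 : 'rV[R]_d)
  (dO dS : measure_display)
  (Omega : measurableType dO) (P : probability Omega R)
  (S : measurableType dS)
  (X : S -> 'rV[R]_d -> 'rV[R]_d) (U : {RV P >-> S})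
  (X_meas : product_measurable X)
  (XU_reg : locally_regular p X U)
  (theta : nat -> Omega -> 'rV[R]_d)
  (theta_adam : is_adam X U gamma alpha beta eps x0 theta)
  (p1 p2 q : R)
  (p1_gt0 : 0 < p1) (p2_gt0 : 0 < p2) (q_gt0 : 0 < q)
  (p2_gt1 : 1 < p2) (p2_le2 : p2 <= 2)
  (p1_gt : 1 / 2 * p2 + 1 < p1) (p1_le : p1 <= 3 / 2 * p2)
  (q_lt : q < Num.sqrt beta)
  (f : 'rV[R]_d -> R)
  (f_C1 : is_C1 f)
  (X_grad : forall x i,
    ('E_P[fun w => X (U w) x ord0 i] = (- grad f x ord0 i)%:E)%E)
  (C : set 'rV[R]_d)
  (C_closed : closed C) (C_neq0 : C !=set0)
  (C_crit : C `<=` [set x | grad f x = 0])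
  (K : set 'rV[R]_d) (K_compact : compact K)
  (local_cond : exists (D : set 'rV[R]_d) (C1 C2 : R),
    [/\ open D, C `&` K `<=` D, 0 < C1, 0 < C2 &
     [/\ C `&` closure D = argmin_on f (closure D),
         argmin_on f (closure D) = [set x | closure D x /\ grad f x = 0],
         (forall x i, D x ->
            ('E_P[fun w => (`|X (U w) x ord0 i| ^+ 3)%R]
             <= (C1 * enorm (grad f x) `^ p1)%:E)%E) &
         (forall x i, D x ->
            (P [set w | (`|X (U w) x ord0 i| ^+ 2
                         < C2 * `|grad f x ord0 i| `^ p2)%R]
             <= q%:E)%E)]]) :
  exists V : set 'rV[R]_d, set_nbhs (C `&` K) V /\
    {ae P, forall w,
       (lim_sup_set (fun n => [set w' | V (theta n w')])
        `&` \bigcup_n0 \bigcap_(n >= n0) [set w' | K (theta n w')]) w ->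
       edist_set (theta n w) C @[n --> \oo] --> (0 : R)}.
Proof.
move: theta_adam => [Us [m [v [sigma [iid init step]]]]].
move: local_cond => [D [C1 [C2 [oD AD C10 C20 [Cargmin argmin_crit E3 _]]]]].
have [df cg] := f_C1.
have dR : 0 < d%:R :> R by rewrite ltr0n.
have b0 : 0 < beta by apply: le_lt_trans beta_gt; exact: sqr_ge0.
have sb1 : Num.sqrt beta < 1 by rewrite -[ltRHS]sqrtr1 ltr_sqrt.
have p0 : 0 < p by apply: lt_le_trans p_ge2.
have [B B0 lin] := adam_direction_linearized eps_gt0 beta_gt beta_lt1.
pose c := (1 - Num.sqrt beta) * eps.
have c0 : 0 < c by rewrite mulr_gt0// subr_gt0.
pose k1 := B / eps / (1 - Num.sqrt beta).
have k10 : 0 < k1 by rewrite !divr_gt0// subr_gt0.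
(* the relative error for which the drift of Adam has the constant that
   [confined_descent_cvg] requires *)
pose eta := (2 * eps * d%:R)^-1 / k1.
have eta0 : 0 < eta by rewrite divr_gt0// invr_gt0 !mulr_gt0.
have p1_gt32 : 3 / 2 < p1 by lra.
have [u1 u10 temperedE] := tempered_sqr_moment_le p1_gt32 C10 c0 (divr_gt0 eta0 dR).
(* the bound [u1] is for the Euclidean norm, which is at most [d] times the
   norm of the topology *)
pose u0 := u1 / d%:R.
have u00 : 0 < u0 by rewrite divr_gt0.
have [V [AV HV]] := confined_descent_cvg d_gt0 eps_gt0 B0 u00 f_C1 C_closed
  K_compact oD AD C_crit Cargmin argmin_crit.
exists V; split=> //.
have mtheta := @adam_measurable _ _ Omega S R d X gamma alpha beta eps x0
  (fun k => Us k) theta m v sigma X_meas eps_gt0 init step.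
have mX j : measurable_fun [set: S * borelRV R d]
    (fun z : S * borelRV R d => X z.1 z.2 ord0 j).
  have mc : measurable_fun [set: borelRV R d] (fun x : borelRV R d => (x : 'rV[R]_d) ord0 j).
    by apply: measurable_borelRV => y; exact: coord_continuous.
  exact: (measurableT_comp mc X_meas).
have mXU j x : measurable_fun [set: Omega] (fun w => X (U w) x ord0 j).
  apply: (measurableT_comp (mX j) (g := fun w : Omega => (U w, x : borelRV R d))).
  exact: measurable_fun_pair.
have mgrad j : measurable_fun [set: borelRV R d] (fun x : borelRV R d => grad f x ord0 j).
  apply: measurable_borelRV => x.
  apply: (@continuous_comp _ _ _ (grad f) (fun y : 'rV[R]_d => y ord0 j)); first exact: cg.
  exact: coord_continuous.
have cng : continuous (fun x => `|grad f x|).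
  by move=> x; apply: (@continuous_comp _ _ _ (grad f)); [exact: cg|exact: norm_continuous].
have mtemp j : measurable_fun [set: S * borelRV R d]
    (fun z : S * borelRV R d => tempered_sqr c (X z.1 z.2 ord0 j)).
  exact: (measurableT_comp (measurable_tempered_sqr c0) (mX j)).
have mK : measurable (K : set (borelRV R d)).
  rewrite -[K]setCK; apply: measurableC; apply: sub_sigma_algebra.
  by apply: closed_openC; apply: compact_closed.
pose G : set 'rV[R]_d := [set x | [/\ K x, D x & `|grad f x| < u0]].
have mG : measurable (G : set (borelRV R d)).
  have -> : G = K `&` (D `&` [set x | `|grad f x| < u0]).
    by rewrite predeqE => x; split=> [[]|[? []]].
  apply: measurableI => //; apply: sub_sigma_algebra; apply: openI => //.
  by apply: (open_comp _ (@open_lt _ u0)) => x _; exact: cng.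
have [Vp Vp0 momK] := moment_bounded_on_compact p0 X_meas XU_reg K_compact.
(* one constant for all moments and mean bounds below *)
pose VV := Vp + u0 + eta * u0.
have eu0 : 0 <= eta * u0 := mulr_ge0 (ltW eta0) (ltW u00).
have VV0 : 0 <= VV by rewrite !addr_ge0 ?(ltW u00).
have VpV : (Vp%:E <= VV%:E)%E by rewrite lee_fin /VV -addrA lerDl addr_ge0 ?(ltW u00).
have EX j x : (\int[P]_w (X (U w) x ord0 j)%:E = (- grad f x ord0 j)%:E)%E.
  by have := X_grad x j; rewrite unlock.
have gV j x : G x -> `|grad f x ord0 j| <= VV.
  move=> [_ _ /ltW gx]; apply: (le_trans (rV_coord_le _ _)); apply: (le_trans gx).
  by rewrite /VV addrAC lerDr addr_ge0 ?(ltW u00).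
have ae1 j : {ae P, forall w, window_sums_negligible gamma (fun k => G (theta k w))
     (fun k => X (Us k.+1 w) (theta k w) ord0 j - - grad f (theta k w) ord0 j)}.
  apply: (noise_negligible_ae (h := fun u x => X u x ord0 j)
    (mu := fun x => - grad f x ord0 j) iid mtheta gamma_gt0 gamma_decr gamma_cvg0
    gamma_summable (mX j) _ mG p_ge2 VV0).
    exact: measurableT_comp.
  move=> x Gx; split; last by rewrite normrN; exact: gV.
    by apply: le_trans VpV; apply: momK; case: Gx.
  by rewrite EX.
have ae2 j : {ae P, forall w, window_sums_negligible gamma (fun k => G (theta k w))
     (fun k => - X (Us k.+1 w) (theta k w) ord0 j - grad f (theta k w) ord0 j)}.
  apply: (noise_negligible_ae (h := fun u x => - X u x ord0 j)
    (mu := fun x => grad f x ord0 j) iid mtheta gamma_gt0 gamma_decr gamma_cvg0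
    gamma_summable _ (mgrad j) mG p_ge2 VV0).
    exact: measurableT_comp.
  move=> x Gx; split; last exact: gV.
    under eq_integral do rewrite normrN.
    by apply: le_trans VpV; apply: momK; case: Gx.
  rewrite (eq_integral (fun w => (- 1)%:E * (X (U w) x ord0 j)%:E)%E); last first.
    by move=> w _; rewrite -EFinM mulN1r.
  have [iX _ _] := integrable_sqr_moment p_ge2 (mXU j x) (momK x j (let: And3 a _ _ := Gx in a)).
  by rewrite integralZl// EX -EFinM mulN1r opprK.
have ae3 j : {ae P, forall w, window_sums_negligible gamma (fun k => G (theta k w))
     (fun k => tempered_sqr c (X (Us k.+1 w) (theta k w) ord0 j) - eta * `|grad f (theta k w)|)}.
  apply: (noise_negligible_ae (h := fun u x => tempered_sqr c (X u x ord0 j))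
    (mu := fun x => eta * `|grad f x|) iid mtheta gamma_gt0 gamma_decr gamma_cvg0
    gamma_summable (mtemp j) _ mG p_ge2 VV0).
    by apply: measurable_funM => //; exact: measurable_borelRV.
  move=> x Gx; have [Kx Dx gx] := Gx; split.
  - apply: le_trans VpV; apply: le_trans (momK x j Kx).
    have mpow := @measurable_powR R p.
    apply: ge0_le_integral => //.
    + apply/measurable_EFinP; apply: (measurableT_comp mpow); apply: measurableT_comp => //.
      exact: (measurableT_comp (measurable_tempered_sqr c0)).
    + by apply/measurable_EFinP; apply: (measurableT_comp mpow); exact: measurableT_comp.
    + move=> w _; rewrite lee_fin; apply: ge0_ler_powR; rewrite ?nnegrE ?(ltW p0)//.
      by rewrite ger0_norm ?tempered_sqr_ge0// tempered_sqr_le_norm.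
  - apply: (@le_trans _ _ ((eta / d%:R * enorm (grad f x))%:E)).
      apply: temperedE => //; first exact: sqrtr_ge0.
        apply: (le_trans (enorm_le_norm _)); rewrite mulrC -ler_pdivlMr//.
        exact: ltW.
      by have := E3 x j Dx; rewrite unlock.
    rewrite lee_fin -mulrA ler_wpM2l ?(ltW eta0)// mulrC ler_pdivrMr// mulrC.
    exact: enorm_le_norm.
  - rewrite ger0_norm; last exact: (mulr_ge0 (ltW eta0)).
    apply: (@le_trans _ _ (eta * u0)); first by rewrite ler_wpM2l ?ltW.
    by rewrite /VV lerDr addr_ge0 ?(ltW u00).
pose kap : R := 1 / 3 + 1 / p.
have ae4 : forall j, {ae P, forall w, exists n0, forall n, (n0 <= n)%N -> K (theta n w) ->
     `|X (Us n.+1 w) (theta n w) ord0 j| <= gamma n.+1 `^ (- kap)}.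
  move=> j; exact: (eventually_small_innovation (h := fun u x => X u x ord0 j) iid mtheta
    gamma_gt0 gamma_summable (mX j) mK p_ge2 (fun x => momK x j)).
have aeall : {ae P, forall w, forall j, [/\
   window_sums_negligible gamma (fun k => G (theta k w))
     (fun k => X (Us k.+1 w) (theta k w) ord0 j - - grad f (theta k w) ord0 j),
   window_sums_negligible gamma (fun k => G (theta k w))
     (fun k => - X (Us k.+1 w) (theta k w) ord0 j - grad f (theta k w) ord0 j),
   window_sums_negligible gamma (fun k => G (theta k w))
     (fun k => tempered_sqr c (X (Us k.+1 w) (theta k w) ord0 j) - eta * `|grad f (theta k w)|) &
   exists n0, forall n, (n0 <= n)%N -> K (theta n w) ->
     `|X (Us n.+1 w) (theta n w) ord0 j| <= gamma n.+1 `^ (- kap)]}.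
  apply: filter_forall; move=> i.
  apply: filterS3 (ae1 i) (ae2 i) (filterI (ae3 i) (ae4 i)) => w ? ? [? ?].
  by split.
move: aeall; apply: filterS => w Hw [ioV [n0 _ evK]].
pose s := 1 - kap.
have pV : 1 / p <= 1 / 2 by rewrite !div1r lef_pV2 ?posrE.
have pV0 : 0 < 1 / p by rewrite divr_gt0.
have s01 : 0 < s <= 1 by apply/andP; split; rewrite /s /kap; lra.
have coord j : [/\
    forall n, `|theta n.+1 w ord0 j - theta n w ord0 j| <= B * gamma n.+1 &
    forall del, 0 < del -> exists n0, forall n N, (n0 <= n)%N -> (n <= N)%N ->
      (forall k, (n <= k)%N -> (k < N)%N -> G (theta k w)) ->
      `|theta N w ord0 j - theta n w ord0 j
         + eps^-1 * \sum_(n <= k < N) gamma k.+1 * grad f (theta k w) ord0 j|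
        <= (2 * eps * d%:R)^-1 * \sum_(n <= k < N) gamma k.+1 * `|grad f (theta k w)|
           + del * (1 + \sum_(n <= k < N) gamma k.+1)].
  pose x k := X (Us k.+1 w) (theta k w) ord0 j.
  pose dir k := (Num.sqrt (v k w ord0 j / (1 - beta ^+ k)) + eps)^-1 * m k w ord0 j.
  have m0 : m 0%N w ord0 j = 0 by have [_ -> _] := init w; rewrite mxE.
  have v0 : v 0%N w ord0 j = 0 by have [_ _ ->] := init w; rewrite mxE.
  have mS n : m n.+1 w ord0 j = alpha * m n w ord0 j + (1 - alpha) * x n.
    by have [] := step n w j.
  have vS n : v n.+1 w ord0 j = beta * v n w ord0 j + (1 - beta) * x n ^+ 2.
    by have [] := step n w j.
  have thS n : theta n.+1 w ord0 j = theta n w ord0 j + gamma n.+1 * dir n.+1.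
    by have [_ _ sE ->] := step n w j; rewrite sE /dir mulrA.
  have linj := lin x (fun n => m n w ord0 j) (fun n => v n w ord0 j) m0 v0 mS vS.
  split.
    move=> n; rewrite thS addrAC subrr add0r normrM gtr0_norm ?gamma_gt0// mulrC.
    have [dB _] := linj n; apply: ler_wpM2r; last exact: dB.
    by rewrite ltW// gamma_gt0.
  have [n1 n2 n3 [nn tailj]] := Hw j.
  have g0 n : 0 < gamma n.+1 `^ (- kap) by rewrite powR_gt0// gamma_gt0.
  have [A A0 xA] : exists2 A, 0 <= A & forall n, `|x n| <= A * gamma n.+1 `^ (s - 1).
    have -> : s - 1 = - kap by rewrite /s; ring.
    apply: eventually_le_global => //; exists (maxn n0 nn) => n.
    by rewrite geq_max => /andP[n0n nnn]; apply: tailj => //; exact: evK.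
  have kE : k1 * eta = (2 * eps * d%:R)^-1.
    by rewrite /eta mulrC divfK// lt0r_neq0.
  have := @adam_drift R alpha beta eps s A B eta gamma (fun n => theta n w ord0 j) x
    (fun n => m n w ord0 j) dir (fun k => grad f (theta k w) ord0 j)
    (fun k => `|grad f (theta k w)|) (fun k => G (theta k w)).
  rewrite -/k1 kE; apply=> //.
  - by move=> n; have [] := linj n.
  - by move=> del /n1[n' Hn']; exists n' => n N a1 a2 a3; have := Hn' n N a1 a2 a3;
      under eq_bigr do rewrite opprK.
apply: (HV (fun n => theta n w) gamma) => //.
- move=> k; apply: rV_norm_le; first by rewrite mulr_ge0// ltW// gamma_gt0.
  by move=> i; rewrite !mxE; have [] := coord i.
- move=> del del0.
  have [N HN] := choice (fun j => let: conj _ H := coord j in H del del0).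
  exists (\max_j N j) => n N' nn nN Gk j; apply: HN => //.
  by apply: leq_trans nn; exact: leq_bigmax.
- by exists n0.
- by move=> n1; have [n nn Vn] := ioV n1 I; exists n.
Qed.
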